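(* Let $X$ be a normal space with $\dim X=n$ and let $m\ge n+1$. Then $C^*(X,\mathbb{R}^m)$ equipped with the uniform convergence topology contains a dense $G_\delta$-subset $\mathcal{H}$ consisting of maps $g$ such that $\overline{g(X)}\cap\Pi^d$ is at most $(n+d-m)$-dimensional for every $d$-plane $\Pi^d\subset\mathbb{R}^m$ with $m-n\le d\le m$.
   Context: All maps are continuous and all spaces are at least completely regular (Hausdorff). $\dim$ is covering dimension ($\dim\emptyset=-1$). $C^*(X,\mathbb{R}^m)$ is the set of all bounded continuous maps $X\to\mathbb{R}^m$; the uniform convergence topology is the one generated by the sup-metric. A $d$-plane is a $d$-dimensional affine plane in $\mathbb{R}^m$. $\overline{g(X)}$ is the closure in $\mathbb{R}^m$. *)

(* Defs.v *)
From HB Require Import structures.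
From mathcomp Require Import all_boot all_order all_algebra.
From mathcomp Require Import all_classical all_reals all_analysis.
Import Order.TTheory GRing.Theory Num.Theory.
Import numFieldNormedType.Exports.

Set Implicit Arguments.
Unset Strict Implicit.
Unset Printing Implicit Defensive.

Local Open Scope classical_set_scope.
Local Open Scope ring_scope.

(* dim T <= k: every finite open cover has a finite open refinement in which
   every point lies in at most k + 1 members. This is the usual definition of
   the covering dimension of a normal space, where it agrees with the one by
   cozero covers used for Tychonoff spaces. Integer values of k allow
   dim = -1, which holds exactly for the empty space; the bound -1 <= k rules
   out values below -1, which the empty space would otherwise admit. *)
Definition dim_le (T : topologicalType) (k : int) : Prop :=
  -1 <= k /\
  forall (I : finType) (U : I -> set T),
    (forall i, open (U i)) -> \bigcup_i U i = [set: T] ->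
    exists (J : finType) (V : J -> set T),
      [/\ forall j, open (V j),
          \bigcup_j V j = [set: T],
          forall j, exists i, V j `<=` U i &
          forall x : T, (#|[pred j | x \in V j]|%:Z <= k + 1)%R].

Definition dim_eq (T : topologicalType) (k : int) : Prop :=
  dim_le T k /\ ~ dim_le T (k - 1).

(* C^*(X, R^m) inside the space of all functions with the topology of uniform
   convergence; used as a type, it carries the induced topology. The norm of
   'rV[R]_m is the max norm, which yields the same bounded maps and the same
   uniform convergence as the Euclidean one. *)
Definition Cstar (R : realType) (X : topologicalType) (m : nat) :
    set {uniform X -> 'rV[R]_m} :=
  [set f | continuous (f : X -> 'rV[R]_m) /\
           bounded_fun (f : X -> 'rV[R]_m)].
Arguments Cstar : clear implicits.

Definition affine_plane (R : realType) (m d : nat) (P : set 'rV[R]_m) : Prop :=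
  exists (p : 'rV[R]_m) (V : {vspace 'rV[R]_m}),
    \dim V = d /\ P = [set x | x - p \in V].

(* Main.v *)
Require Import Defs.
From HB Require Import structures.
From mathcomp Require Import all_boot all_order all_algebra.
From mathcomp Require Import all_classical all_reals all_analysis.
From mathcomp Require Import borel_hierarchy.
From mathcomp Require Import ring lra zify.
Import Order.TTheory GRing.Theory Num.Theory.
Import numFieldNormedType.Exports.

(** Let [K] be the closure of [g(X)], let [c = m - d] be the codimension of the
    plane and [k = n - c] the bound to be proved.

    Dimension is measured with cubical grids. If no point of a compact set has
    more than [k] coordinates on some translate of the grid of mesh [eps], then
    the set is covered by [k + 1] disjoint families of open sets of size at
    most [eps], one for each number of coordinates close to the grid
    ([dim_le_grid]). So it suffices that, for each small [eps], every plane of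
    codimension [c] has a translate of the grid for which the points of [K] on
    the plane have at most [k] grid coordinates ([grid_thin]). The planes
    that meet a bounded set form a compact family, so this condition is open
    in [g] ([grid_thin_stable]), and by the Baire category theorem
    ([bmap_baire]) what remains is that it is dense.

    For density, [f] is approximated by a map into a complex of dimension [n]
    with tiny simplices, using a partition of unity ([pl_approximation]). A
    simplex in general position with respect to the plane meets it in dimension
    at most [k], and a finite union of pieces of dimension [k] has at most [k]
    grid coordinates at each point once the grid is translated generically. A
    simplex that meets the plane but is not in general position contains at
    most [c] vertices whose offsets from the plane are linearly dependent. Such
    a simplex may meet the plane in too large a dimension, and since all planes
    are considered at once these simplices cannot be avoided by the choice of
    the vertices. But their number can be controlled: a plane has
    [c * m + c] parameters and each dependence among vertices imposes one
    condition, so for generic vertices no plane has more than [c * m + c]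
    pairwise disjoint dependent sets ([generic_vertices]). Hence all these
    simplices have a vertex in a set of vertices whose size is bounded in terms
    of [c] and [m] alone ([disjoint_or_hitting]). They lie in boundedly many
    tiny balls, and a suitable translate of the grid misses these balls
    altogether ([slice_grid]). *)

Set Implicit Arguments.
Unset Strict Implicit.
Unset Printing Implicit Defensive.

Local Open Scope classical_set_scope.
Local Open Scope ring_scope.

(** * Two counting arguments *)

(** A set of points that depends in a Lipschitz way on fewer parameters than its
points have coordinates cannot contain a fine grid: [M ^ #|B|] grid points of
mesh [eta / M] would need distinct parameters up to a precision proportional
to [1 / M], and there are only [O(M ^ (#|B| - 1))] of these. The parametrized
points are given by a relation, one for each label [t : T], and only the
coordinates in [D t] of the parameter [x] are used to recover the point. *)
Lemma few_parameters_avoid (R : realType) (T E B : finType) (D : T -> {set E}) (C : R)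
    (Rel : T -> (E -> R) -> (B -> R) -> Prop) :
  0 < C -> (forall t, (#|D t| < #|B|)%N) ->
  (forall t x y, Rel t x y -> forall e, `|x e| <= C) ->
  (forall t x x' y y' k, 0 <= k -> Rel t x y -> Rel t x' y' ->
     (forall e, e \in D t -> `|x e - x' e| <= k) ->
     forall b, `|y b - y' b| <= C * k) ->
  forall (y0 : B -> R) (eta : R), 0 < eta ->
  exists y : B -> R, (forall b, `|y b - y0 b| <= eta) /\
                     forall t x, ~ Rel t x y.
Proof.
move=> C0 ltDB bdx lip y0 eta eta0.
apply: contrapT => none.
pose a := #|B|.-1.
have [K1 K1P] : exists K1 : nat, 4 * C * C / eta <= K1%:R.
  exists (Num.bound (4 * C * C / eta)).
  apply: ltW; apply: archi_boundP; apply: divr_ge0; last exact: ltW.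
  by rewrite !mulr_ge0 // ltW.
pose K := K1.+1.
pose M := (#|T| * K ^ a).+1.
have M0 : 0 < M%:R :> R by rewrite ltr0n.
pose k := eta / (2 * C * M%:R).
have k0 : 0 < k by rewrite divr_gt0 ?mulr_gt0.
pose pt (i : {ffun B -> 'I_M}) (b : B) := y0 b + eta / M%:R * (i b)%:R.
have bad i : exists tx : T * (E -> R), Rel tx.1 tx.2 (pt i).
  apply: contrapT => nbad; apply: none; exists (pt i); split.
    move=> b; rewrite /pt addrC addKr ger0_norm; last first.
      by rewrite mulr_ge0 // divr_ge0 // ltW.
    rewrite -mulrA ger_pMr // mulrC ler_pdivrMr // mul1r ler_nat.
    exact/ltnW/ltn_ord.
  by move=> t x Rtx; apply: nbad; exists (t, x).
have /choice[h hP] := bad.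
have KM0 : (0 < K * M)%N by [].
pose rd (z : R) : 'I_(K * M) := insubd (Ordinal KM0) (Num.truncn ((z + C) / k)).
have rdP z : `|z| <= C -> ((rd z)%:R <= (z + C) / k < (rd z)%:R + 1).
  rewrite ler_norml => /andP[zl zu].
  have z0 : 0 <= (z + C) / k.
    by rewrite divr_ge0 ?(ltW k0) // -[C]opprK subr_ge0.
  have -> : rd z = Num.truncn ((z + C) / k) :> nat.
    rewrite /rd val_insubd ifT // truncn_lt_nat //.
    apply: (@le_lt_trans _ _ (K1 * M)%:R); last by rewrite ltr_nat ltn_mul2r /=.
    apply: (@le_trans _ _ (2 * C / k)).
      by rewrite ler_pM2r ?invr_gt0 // mulrDl mul1r lerD2r.
    rewrite natrM /k invfM invrK.
    have -> : 2 * C * (eta^-1 * (2 * C * M%:R)) = 4 * C * C / eta * M%:R by ring.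
    by rewrite ler_pM2r.
  by rewrite natr1 truncn_itv.
(* the label and the rounded parameters of a bad grid point *)
pose Phi (i : {ffun B -> 'I_M}) : T * {ffun 'I_a -> 'I_(K * M)} :=
  ((h i).1, [ffun j : 'I_a => rd (nth 0 [seq (h i).2 e | e <- enum (D (h i).1)] j)]).
have Phi_inj : injective Phi.
  move=> i i' [et /ffunP er]; apply/ffunP => b; apply/val_inj/eqP.
  have R1 := hP i; have R2 := hP i'; rewrite -et in R2.
  have cl : forall e, e \in D (h i).1 -> `|(h i).2 e - (h i').2 e| <= k.
    move=> e eD.
    have ltj : (index e (enum (D (h i).1)) < a)%N.
      rewrite /a -ltnS prednK; last by apply: leq_ltn_trans (ltDB (h i).1).
      by apply: leq_ltn_trans (ltDB (h i).1); rewrite cardE index_mem mem_enum.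
    have := er (Ordinal ltj); rewrite !ffunE /= -et.
    have lts : (index e (enum (D (h i).1)) < size (enum (D (h i).1)))%N.
      by rewrite index_mem mem_enum.
    rewrite !(nth_map e) // !nth_index ?mem_enum // => rde.
    have /andP[l1 u1] := rdP _ (bdx _ _ _ R1 e).
    have /andP[l2 u2] := rdP _ (bdx _ _ _ R2 e).
    rewrite -rde in l2 u2.
    have : `|((h i).2 e + C) / k - ((h i').2 e + C) / k| <= 1.
      by rewrite ler_norml; apply/andP; split; lra.
    rewrite -mulrBl normrM [`|k^-1|]gtr0_norm ?invr_gt0 // ler_pdivrMr // mul1r.
    by rewrite opprD addrACA subrr addr0.
  have := lip _ _ _ _ _ _ (ltW k0) R1 R2 cl b.
  rewrite /pt opprD addrACA subrr add0r -mulrBr normrM gtr0_norm ?divr_gt0 //.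
  have -> : C * k = eta / M%:R * 2^-1.
    by rewrite /k; field; rewrite !gt_eqF.
  rewrite ler_pM2l ?divr_gt0 // => lt2.
  apply: contraTT lt2 => ne; rewrite -ltNge.
  apply: (@lt_le_trans _ _ 1); first by lra.
  wlog : i i' {et er R1 R2 cl} ne / (i b < i' b)%N => [wl|lt].
    move: (ne); rewrite neq_ltn => /orP[|] lt; first exact: wl.
    by rewrite distrC; apply: wl => //; rewrite eq_sym.
  rewrite distrC -natrB ?(ltnW lt) // ger0_norm // ler1n subn_gt0 //.
have := leq_card _ Phi_inj.
rewrite card_prod !card_ffun !card_ord.
have B0 : (0 < #|B|)%N.
  case: (pickP (fun _ : T => true)) => [t _|T0]; first exact: leq_ltn_trans (ltDB t).
  by have [tx _] := bad [ffun=> ord0]; have := T0 tx.1.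
rewrite -{1}(prednK B0) -/a expnS expnMn mulnA leq_pmul2r ?expn_gt0 //.
by rewrite /M ltnn.
Qed.

(** A greedy choice: the union of a maximal disjoint family meets every set of the
family. *)
Lemma disjoint_or_hitting (T : finType) (P : {set T} -> Prop) (c s : nat) :
  (forall A, P A -> (#|A| <= c)%N) ->
  (exists A : 'I_s -> {set T}, (forall i, P (A i)) /\
      (forall i j, i != j -> [disjoint A i & A j]%B)) \/
  (exists Y : {set T}, (#|Y| <= s * c)%N /\
      forall A, P A -> ~~ [disjoint A & Y]).
Proof.
move=> Pc; elim: s => [|s [[A [PA dA]]|[Y [cY hY]]]].
- by left; exists (fun=> finset.set0); split; case.
- pose Y := (\bigcup_i A i)%SET.
  have cY : (#|Y| <= s * c)%N.
    have Ysum : (#|Y| <= \sum_(i < s) #|A i|)%N.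
      rewrite /Y; elim/big_rec2: _ => [|i y x _ le]; first by rewrite cards0.
      by rewrite (leq_trans (leq_card_setU _ _)) // leq_add2l.
    apply: leq_trans Ysum _; rewrite -[X in (X * _)%N]card_ord -sum_nat_const.
    by apply: leq_sum => i _; exact: Pc.
  have [hY|] := pselect (forall A0, P A0 -> ~~ [disjoint A0 & Y]).
    by right; exists Y; split => //; rewrite (leq_trans cY) // leq_mul2r leqnSn orbT.
  move=> /existsNP[A0 /not_implyP[PA0 /negP/negPn dA0]].
  have dA0i i : [disjoint A0 & A i]%B.
    apply: disjointWr dA0; exact: finset.bigcup_sup.
  left; exists (fun i : 'I_s.+1 => if unlift ord0 i is Some j then A j else A0).
  split=> [i|i j]; first by case: unliftP.
  case: unliftP => [i' ->|->]; case: unliftP => [j' ->|->] //=.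
  - by rewrite (inj_eq lift_inj) => /dA.
  - by rewrite disjoint_sym.
- right; exists Y; split => //.
  by rewrite (leq_trans cY) // leq_mul2r leqnSn orbT.
Qed.

(** * Vertices in general position with respect to all planes *)

(** A plane of codimension [c] is [[set x | x *m B = b]] for some [B] of this form:
the bound on the entries makes the family of all [B] compact, and the identity
block lets [c] coordinates of a point of the plane be solved for. *)
Definition normalized (R : realType) (m c : nat) (B : 'M[R]_(m, c)) : Prop :=
  (forall i j, `|B i j| <= 1) /\
  exists f : 'I_c -> 'I_m, forall i j, B (f i) j = (i == j)%:R.

Definition dependent (R : realType) (N c : nat) (w : 'M[R]_(N, c))
    (A : {set 'I_N}) : Prop :=
  exists2 u : 'I_N -> R, (exists2 v, v \in A & u v != 0) &
    forall j, \sum_(v in A) u v * w v j = 0.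

Lemma dual_family_inj (R : realType) (T : Type) (c : nat) (f : 'I_c -> T)
    (B : T -> 'I_c -> R) :
  (forall i j, B (f i) j = (i == j)%:R) -> injective f.
Proof.
move=> Bf i j fij; have := Bf i j; rewrite fij Bf eqxx.
by case: (i =P j) => // _ /eqP; rewrite oner_eq0.
Qed.

(** Dividing by the coefficient of largest absolute value bounds the others by 1,
which keeps the parameters of a dependence in a bounded box. *)
Lemma dependent_pivot (R : realType) (N c : nat) (w : 'M[R]_(N, c))
    (A : {set 'I_N}) :
  dependent w A -> exists2 p, p \in A & exists2 u : 'I_N -> R,
    (forall v, `|u v| <= 1) &
    forall j, w p j = \sum_(v in A | v != p) u v * w v j.
Proof.
case=> u [v0 v0A uv0] sum0.
case: (@arg_maxP _ _ _ v0 (fun v => v \in A) (fun v => `|u v|) v0A) => p pA pmax.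
exists p => //.
have up0 : u p != 0.
  by rewrite -normr_gt0 (lt_le_trans _ (pmax _ v0A)) // normr_gt0.
exists (fun v => if v \in A then - (u v / u p) else 0) => [v|j].
  case: ifP => [vA|_]; last by rewrite normr0.
  by rewrite normrN normf_div ler_pdivrMr ?normr_gt0 // mul1r; exact: pmax.
have /eqP := sum0 j; rewrite (bigD1 p) //= addr_eq0 => /eqP e.
apply: (mulfI up0); rewrite e mulr_sumr -sumrN; apply: eq_bigr => v /andP[-> _].
by rewrite -mulNr mulrA mulrN mulrCA divff // mulr1.
Qed.

(** Row [v] vanishes exactly when vertex [v] lies on the plane [x *m B = b]; a
convex combination of vertices lies on the plane when the same combination of
the offsets vanishes. *)
Definition offset (R : realType) (N m c : nat) (V : 'M[R]_(N, m))
  (B : 'M[R]_(m, c)) (b : 'rV[R]_c) : 'M[R]_(N, c) :=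
  \matrix_(v, j) ((V *m B) v j - b 0 j).

Lemma ler_dist_mul (R : realType) (K K' k1 k2 a a' b b' : R) :
  `|a| <= K -> `|b'| <= K' -> `|a - a'| <= k1 -> `|b - b'| <= k2 ->
  `|a * b - a' * b'| <= K * k2 + K' * k1.
Proof.
move=> aK bK ak bk.
have -> : a * b - a' * b' = a * (b - b') + b' * (a - a') by ring.
by rewrite (le_trans (ler_normD _ _)) // !normrM lerD // ler_pM.
Qed.

Lemma ler_dist_sum (R : realType) (I : finType) (P : pred I) (F G : I -> R) (k : R) :
  0 <= k -> (forall i, P i -> `|F i - G i| <= k) ->
  `|\sum_(i | P i) F i - \sum_(i | P i) G i| <= #|I|%:R * k.
Proof.
move=> k0 FG; rewrite -sumrB (le_trans (ler_norm_sum _ _ _)) //.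
rewrite (le_trans (ler_sum _ FG)) // mulr_natl -sumr_const.
by rewrite [leRHS](bigID P) /= lerDl sumr_ge0.
Qed.

(** A dependence among the offsets of at most [c] vertices expresses the offset of
one of them, the pivot, by at most [c - 1] coefficients and the offsets of the
others. This determines [c] coordinates of the pivot, so each dependence
removes one free parameter. A plane brings [c * m + c] parameters; if more than
that many disjoint sets of vertices are dependent for the same plane, then the
vertices depend on fewer parameters than they have coordinates. *)
Lemma generic_vertices (R : realType) (N m c : nat) (V0 : 'M[R]_(N, m))
    (eta r : R) : 0 < eta ->
  exists2 V : 'M[R]_(N, m), (forall v a, `|V v a - V0 v a| <= eta) &
  forall (B : 'M[R]_(m, c)) (b : 'rV[R]_c), normalized B ->
    (forall j, `|b 0 j| <= r) ->
  ~ exists A : 'I_(c * m + c).+1 -> {set 'I_N},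
      (forall l, (#|A l| <= c)%N /\ dependent (offset V B b) (A l)) /\
      (forall l l', l != l' -> [disjoint A l & A l']%B).
Proof.
move=> eta0.
set s := (c * m + c).+1.
pose T : finType := ({ffun 'I_c -> 'I_m} * {ffun 'I_s -> {set 'I_N}} *
  {ffun 'I_s -> 'I_N} * {ffun 'I_s -> {ffun 'I_N -> 'I_c}})%type.
pose E : finType := ('I_m * 'I_c + 'I_c + 'I_N * 'I_m)%type.
(* A label records the identity block f, the sets A, their pivots p and a
   numbering nu of each set. The coefficient of v in the l-th dependence is
   stored in place of the coordinate f (nu l v) of the pivot p l, which the
   dependence determines; the place of the pivot itself stays empty. *)
pose slot (t : T) (l : 'I_s) : E := inr (t.1.2 l, t.1.1.1 (t.2 l (t.1.2 l))).
pose D (t : T) : {set E} :=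
  if injectiveb (slot t) then (~: [set slot t l | l : 'I_s])%SET else finset.set0.
pose C0 : R := 1 + `|r| + eta + \sum_v \sum_a `|V0 v a|.
have C01 : 1 <= C0.
  rewrite /C0 -!addrA lerDl !addr_ge0 ?(ltW eta0) //.
  by apply: sumr_ge0 => v _; exact: sumr_ge0.
have C00 : 0 <= C0 by lra.
pose W : R := m%:R * (C0 + C0) + 1.
pose Q : R := m%:R * (C0 * C0) + C0.
pose C : R := C0 + 1 + N%:R * (C0 * W + Q * 1) + m%:R * (C0 + C0).
have m0 : 0 <= m%:R :> R by [].
have W0 : 0 <= W by rewrite addr_ge0 // mulr_ge0 // addr_ge0.
have Q0 : 0 <= Q by rewrite addr_ge0 // !mulr_ge0.
have NWQ : 0 <= N%:R * (C0 * W + Q * 1) by rewrite !mulr_ge0 ?addr_ge0 ?mulr_ge0.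
have mC : 0 <= m%:R * (C0 + C0) by rewrite mulr_ge0 // addr_ge0.
pose off (x : E -> R) (y : 'I_N * 'I_m -> R) v j :=
  \sum_a y (v, a) * x (inl (inl (a, j))) - x (inl (inr j)).
pose Rel (t : T) (x : E -> R) (y : 'I_N * 'I_m -> R) : Prop :=
  let: (f, A, p, nu) := t in
  [/\ (forall e, `|x e| <= C0) /\ (forall e, `|y e| <= C0),
      forall i j, x (inl (inl (f i, j))) = (i == j)%:R,
      (forall l, p l \in A l /\ {in A l &, injective (nu l)}) /\
      (forall l l', l != l' -> [disjoint A l & A l']%B),
      forall v a, (forall l i, (v, a) <> (p l, f i)) -> x (inr (v, a)) = y (v, a) &
      forall l j, off x y (p l) j =
        \sum_(v in A l | v != p l) x (inr (p l, f (nu l v))) * off x y v j].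
have [y [yV0 ybad]] : exists y : 'I_N * 'I_m -> R,
    (forall e, `|y e - V0 e.1 e.2| <= eta) /\ forall t x, ~ Rel t x y.
  apply: (@few_parameters_avoid R T E _ D C Rel) => //.
  - by rewrite /C; lra.
  - move=> t; rewrite /D card_prod !card_ord; case: ifP => [/injectiveP inj|_].
      rewrite cardsCs finset.setCK card_imset // card_ord.
      rewrite !card_sum !card_prod !card_ord /s.
      have [N0 m_0] : (0 < N)%N /\ (0 < m)%N.
        split; first exact: leq_ltn_trans (ltn_ord (t.1.2 ord0)).
        exact: leq_ltn_trans (ltn_ord (t.1.1.1 (t.2 ord0 (t.1.2 ord0)))).
      have NM: (0 < N * m)%N by rewrite muln_gt0 N0.
      rewrite mulnC; lia.
    rewrite cards0 muln_gt0; apply/andP; split.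
      exact: leq_ltn_trans (ltn_ord (t.1.2 ord0)).
    exact: leq_ltn_trans (ltn_ord (t.1.1.1 (t.2 ord0 (t.1.2 ord0)))).
  - move=> [[[f A] p] nu] x y [[bx _] _ _ _ _] e.
    by rewrite (le_trans (bx e)) // /C; lra.
  - move=> [[[f A] p] nu] x x' y y' k k0 [[bx by_] Bf [pA dA] xy rel].
    move=> [[bx' by'] Bf' _ xy' rel'] cl.
    have f_inj := dual_family_inj (B := fun a j => x (inl (inl (a, j)))) Bf.
    have p_inj l l' v : v \in A l -> v = p l' -> l = l'.
      move=> vA vl; apply/eqP; apply: contraT => ne.
      have := disjointFr (dA _ _ ne) vA.
      by rewrite vl (pA l').1.
    have slot_inj : injective (slot (f, A, p, nu)).
      by move=> l l' [pe _]; apply: p_inj pe; exact: (pA l).1.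
    have De e : (forall l, e <> slot (f, A, p, nu) l) -> `|x e - x' e| <= k.
      move=> ne; apply: cl; rewrite /D ifT; last exact/injectiveP.
      by rewrite finset.in_setC; apply/imsetP => -[l _]; exact: ne.
    have cB a j : `|x (inl (inl (a, j))) - x' (inl (inl (a, j)))| <= k by exact: De.
    have cb j : `|x (inl (inr j)) - x' (inl (inr j))| <= k by exact: De.
    have cy v a : (forall l i, (v, a) <> (p l, f i)) -> `|y (v, a) - y' (v, a)| <= k.
      by move=> ne; rewrite -xy // -xy' //; apply: De => l [] ev ea; apply: (ne l _); rewrite ev ea.
    have cprod v a j : (forall l i, (v, a) <> (p l, f i)) ->
        `|y (v, a) * x (inl (inl (a, j))) - y' (v, a) * x' (inl (inl (a, j)))|
        <= (C0 + C0) * k.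
      by move=> ne; rewrite mulrDl; apply: ler_dist_mul => //; exact: cy.
    have coff v j : (forall l, v <> p l) -> `|off x y v j - off x' y' v j| <= W * k.
      move=> ne.
      have := @ler_dist_sum R 'I_m xpredT (fun a => y (v, a) * x (inl (inl (a, j))))
        (fun a => y' (v, a) * x' (inl (inl (a, j)))) ((C0 + C0) * k).
      rewrite card_ord mulrA => /(_ (mulr_ge0 (addr_ge0 C00 C00) k0)).
      move=> /(_ (fun a _ => cprod v a j (fun l i e => ne l (congr1 fst e)))).
      have := cb j; rewrite /off !ler_norml => /andP[? ?] /andP[? ?].
      by rewrite /W mulrDl mul1r; apply/andP; split; lra.
    have boff v j : `|off x' y' v j| <= Q.
      rewrite (le_trans (ler_normB _ _)) // lerD //.
      have := @ler_dist_sum R 'I_m xpredT (fun a => y' (v, a) * x' (inl (inl (a, j)))) (fun=> 0) (C0 * C0).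
      rewrite big1_eq subr0 card_ord; apply; first exact: mulr_ge0.
      by move=> a _; rewrite subr0 normrM ler_pM.
    have goalk : k <= C * k by rewrite ler_peMl // /C; lra.
    move=> [v a].
    have [[l vl]|nvp] := pselect (exists l, v = p l); last first.
      by apply: le_trans goalk; apply: cy => l i [vl _]; apply: nvp; exists l.
    have [[i ai]|naf] := pselect (exists i, a = f i); last first.
      by apply: le_trans goalk; apply: cy => l' i [_ ai]; apply: naf; exists i.
    rewrite {}vl {}ai {v a}.
    have solve z h : (forall i j, z (inl (inl (f i, j))) = (i == j)%:R :> R) ->
        off z h (p l) i = \sum_(v in A l | v != p l) z (inr (p l, f (nu l v))) * off z h v i ->
        h (p l, f i) = (z (inl (inr i)) +
        \sum_(v in A l | v != p l) z (inr (p l, f (nu l v))) * off z h v i) -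
        \sum_(a | a != f i) h (p l, a) * z (inl (inl (a, i))).
      by move=> zf <-; rewrite /off (bigD1 (f i)) //= zf eqxx mulr1 addrCA subrr addr0 addrK.
    (* only the coordinate f i of the pivot has a nonzero weight in row i of
       the identity block, so it is determined by the other data *)
    rewrite (solve x y Bf (rel l i)) (solve x' y' Bf' (rel' l i)) {solve}.
    set S1 := \sum_(_ in _ | _) _; set S2 := \sum_(_ | _) _.
    set S1' := \sum_(_ in _ | _) _; set S2' := \sum_(_ | _) _.
    have d1 : `|S1 - S1'| <= N%:R * ((C0 * W + Q * 1) * k).
      rewrite /S1 /S1' -[N in N%:R]card_ord; apply: ler_dist_sum.
        by rewrite mulr_ge0 // addr_ge0 ?mulr_ge0.
      move=> v /andP[vA vp].
      rewrite mulrDl mulr1 -mulrA; apply: ler_dist_mul => //.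
        apply: De => l' [pe fe].
        have ll' : l = l' by apply: p_inj pe; exact: (pA l).1.
        move: fe; rewrite -ll' => /f_inj fe.
        move: vp; rewrite ((pA l).2 _ _ vA _ fe) ?eqxx //; exact: (pA l).1.
      apply: coff => l' vl'.
      by move: vp; rewrite (p_inj _ _ _ vA vl') -vl' eqxx.
    have d2 : `|S2 - S2'| <= m%:R * ((C0 + C0) * k).
      rewrite /S2 /S2' -[m in m%:R]card_ord; apply: ler_dist_sum.
        by rewrite mulr_ge0 // addr_ge0.
      move=> a ai.
      have [[i' ai']|naf] := pselect (exists i, a = f i).
        rewrite ai' Bf Bf'; have -> : (i' == i) = false.
          by apply/eqP => ii; move: ai; rewrite ai' ii eqxx.
        by rewrite !mulr0 subrr normr0 mulr_ge0 // addr_ge0.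
      by apply: cprod => l' i' [_ ai']; apply: naf; exists i'.
    have := cb i; move: d1 d2; rewrite !ler_norml => /andP[? ?] /andP[? ?] /andP[? ?].
    have -> : C * k = C0 * k + k + N%:R * ((C0 * W + Q * 1) * k) + m%:R * ((C0 + C0) * k).
      by rewrite /C; ring.
    have C0k : 0 <= C0 * k by rewrite mulr_ge0.
    by apply/andP; split; lra.
exists (\matrix_(v, a) y (v, a)) => [v a|B b [B1 [f Bf]] br].
  by rewrite mxE; exact: yV0 (v, a).
case=> A [AP dA].
have /choice[p pP] : forall l, exists p, p \in A l /\ exists2 u : 'I_N -> R,
    (forall v, `|u v| <= 1) &
    forall j, offset (\matrix_(v, a) y (v, a)) B b p j =
      \sum_(v in A l | v != p) u v * offset (\matrix_(v, a) y (v, a)) B b v j.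
  by move=> l; have [p pA pu] := dependent_pivot (AP l).2; exists p.
have /choice[u uP] : forall l, exists u : 'I_N -> R,
    (forall v, `|u v| <= 1) /\
    forall j, offset (\matrix_(v, a) y (v, a)) B b (p l) j =
      \sum_(v in A l | v != p l) u v * offset (\matrix_(v, a) y (v, a)) B b v j.
  by move=> l; have [_ [u u1 up]] := pP l; exists u.
have /choice[nu nuP] : forall l, exists nu : {ffun 'I_N -> 'I_c}, {in A l &, injective nu}.
  move=> l; have c0 : (0 < c)%N.
    by apply: leq_trans (AP l).1; rewrite card_gt0; apply/finset.set0Pn; exists (p l); exact: (pP l).1.
  have h v : v \in A l -> (index v (enum (A l)) < c)%N.
    by move=> vA; apply: leq_trans (AP l).1; rewrite cardE index_mem mem_enum.
  exists [ffun v => insubd (Ordinal c0) (index v (enum (A l)))] => v v' vA vA'.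
  rewrite !ffunE => /(congr1 val); rewrite !val_insubd !h //.
  by move=> /(congr1 (nth v (enum (A l)))); rewrite !nth_index ?mem_enum.
pose x (e : E) : R := match e with
  | inl (inl (a, j)) => B a j
  | inl (inr j) => b 0 j
  | inr (v, a) =>
    if [pick l | p l == v] is Some l then
      if [pick i | f i == a] is Some i then
         if [pick v' in A l | nu l v' == i] is Some v' then u l v' else 0
      else y (v, a)
    else y (v, a) end.
have by_ e : `|y e| <= C0.
  case: e => v a.
  have := yV0 (v, a); rewrite /= -{2}[y (v, a)](subrK (V0 v a)) => le.
  rewrite (le_trans (ler_normD _ _)) //.
  have le2 : `|V0 v a| <= \sum_v \sum_a `|V0 v a|.
    rewrite (bigD1 v) //= (bigD1 a) //= -addrA lerDl addr_ge0 //.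
      exact: sumr_ge0.
    by apply: sumr_ge0 => ? _; exact: sumr_ge0.
  by rewrite /C0; have := normr_ge0 r; lra.
have f_inj := dual_family_inj Bf.
have p_inj : injective p.
  move=> l l' pl; apply/eqP; apply: contraT => ne.
  have := disjointFr (dA _ _ ne) (pP l).1.
  by rewrite pl (pP l').1.
apply: (ybad (([ffun i => f i], [ffun l => A l], [ffun l => p l], [ffun l => nu l]) : T) x).
have offE v j : off x y v j = offset (\matrix_(v, a) y (v, a)) B b v j.
  rewrite /off /offset /= !mxE; congr (_ - _).
  by apply: eq_bigr => a _; rewrite mxE.
split.
- split=> //; case=> [[[a j]|j]|[v a]] /=.
  + exact: le_trans (B1 _ _) C01.
  + rewrite (le_trans (br _)) // (le_trans (ler_norm _)) // /C0.
    have : 0 <= \sum_v \sum_a `|V0 v a| by apply: sumr_ge0 => ? _; exact: sumr_ge0.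
    lra.
  + case: pickP => [l _|_] //; case: pickP => [i _|_] //; case: pickP => [v' _|_] //.
      exact: le_trans ((uP l).1 _) C01.
    by rewrite normr0.
- by move=> i j; rewrite ffunE /= Bf.
- split=> [l|l l' ne]; rewrite !ffunE; last exact: dA.
  by split; [exact: (pP l).1|exact: nuP].
- move=> v a ne /=; case: pickP => [l /eqP pl|_] //; case: pickP => [i /eqP fi|_] //.
  by case: (ne l i); rewrite !ffunE pl fi.
- move=> l j; rewrite !ffunE offE (uP l).2; apply: eq_bigr => v /andP[vA vp].
  rewrite offE /=; congr (_ * _).
  case: pickP => [l' /eqP/p_inj ->|/(_ l)]; last by rewrite eqxx.
  rewrite ffunE; case: pickP => [i /eqP/f_inj ->|/(_ (nu l v))]; last by rewrite eqxx.
  case: pickP => [v' /andP[v'A /eqP/nuP ->]//|/(_ v)].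
  by rewrite vA eqxx.
Qed.

(** * Grids that meet a slice of a complex in few coordinates *)

(** The union of all simplices of dimension at most [n] and diameter at most [eta]
with vertices among the rows of [V]. Simplices may cross one another, since [m]
can be smaller than [2 * n + 1]. *)
Definition star_complex (R : realType) (N m : nat) (V : 'M[R]_(N, m)) (n : nat)
    (eta : R) : set 'rV[R]_m :=
  [set x | exists t : 'rV[R]_N,
     [/\ forall v, 0 <= t 0 v, \sum_v t 0 v = 1,
         (#|[pred v | (t 0 v != 0)%R]| <= n.+1)%N,
         forall v w a, t 0 v != 0 -> t 0 w != 0 -> `|V v a - V w a| <= eta &
         x = t *m V]].

Definition grid_coords (R : realType) (m : nat) (eps : R) (t x : 'rV[R]_m) :
    {set 'I_m} :=
  [set a | `[< exists z : int, x 0 a = t 0 a + eps * z%:~R >]]%SET.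

(** If the simplex spanned by [S] meets the plane but its offsets do not have full
rank [c], then either [S] has at most [c] vertices and the weights are a
dependence, or any [c] of its vertices are dependent. *)
Lemma rank_defect_dependent (R : realType) (N c : nat) (W : 'M[R]_(N, c))
    (t : 'rV[R]_N) (S : {set 'I_N}) :
  (forall v, (v \in S) = (t 0 v != 0)) -> t != 0 -> t *m W = 0 ->
  (\rank (rowsub (@enum_val _ (mem S)) W) < c)%N ->
  exists A : {set 'I_N}, [/\ A \subset S, (#|A| <= c)%N & dependent W A].
Proof.
move=> St t0 tW rk; case: (leqP #|S| c) => [Sc|cS].
  exists S; split => //; exists (fun v => t 0 v).
    have /rV0Pn[v tv] := t0; by exists v; rewrite ?St.
  move=> j; have := congr1 (fun x : 'rV_c => x 0 j) tW; rewrite !mxE => tWj.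
  rewrite -[RHS]tWj [RHS](bigID (mem S)) /= [X in _ = _ + X]big1 ?addr0 // => v.
  by rewrite St negbK => /eqP ->; rewrite mul0r.
pose e (i : 'I_c) : 'I_#|S| := widen_ord (ltnW cS) i.
pose g (i : 'I_c) : 'I_N := enum_val (e i).
have g_inj : injective g by move=> i j /enum_val_inj /(congr1 val) /= /val_inj.
have : (\rank (rowsub g W) < c)%N.
  apply: leq_ltn_trans rk; apply: mxrankS.
  have -> : rowsub g W = rowsub e (rowsub (@enum_val _ (mem S)) W).
    by apply/matrixP => i j; rewrite !mxE.
  exact: rowsub_sub.
move=> rkg; have : kermx (rowsub g W) != 0.
  by rewrite -mxrank_eq0 mxrank_ker subn_eq0 -ltnNge.
case/rowV0Pn => u /sub_kermxP uW u0.
exists [set g i | i : 'I_c]%SET; split.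
- by apply/fintype.subsetP => _ /imsetP[i _ ->]; exact: enum_valP.
- by rewrite card_imset // card_ord.
exists (fun v => \sum_(i | g i == v) u 0 i).
  have /rV0Pn[i ui] := u0; exists (g i); first exact: imset_f.
  rewrite (big_pred1 i) // => j; by rewrite /= (inj_eq g_inj).
move=> j; rewrite big_imset /=; last by move=> ? ? _ _; exact: g_inj.
have := congr1 (fun x : 'rV_c => x 0 j) uW; rewrite !mxE => uWj.
rewrite -[RHS]uWj; apply: eq_bigr => i _; rewrite !mxE; congr (_ * _).
by rewrite (big_pred1 i) // => i'; rewrite /= (inj_eq g_inj).
Qed.

(** If the offsets have full rank, the slice of the simplex by the plane has
dimension at most [k], so its projection to [k + 1] coordinates lies in a
hyperplane. Homogeneous coordinates are used: the last column of [F] is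
constantly 1, which gives the constant term [h0]. *)
Lemma slice_functional (R : realType) (N m c k : nat) (V : 'M[R]_(N, m))
    (W : 'M[R]_(N, c)) (S : {set 'I_N}) (f : 'I_k.+1 -> 'I_m) :
  (#|S| <= k.+1 + c)%N -> \rank (rowsub (@enum_val _ (mem S)) W) = c ->
  exists h : 'I_k.+1 -> R, exists h0 : R,
    ((exists i, h i != 0) \/ h0 != 0) /\
    forall t : 'rV[R]_N, (forall v, v \notin S -> t 0 v = 0) ->
      t *m W = 0 -> \sum_v t 0 v = 1 ->
      \sum_i (t *m V) 0 (f i) * h i + h0 = 0.
Proof.
move=> Sk rk.
pose ev := @enum_val _ (mem S).
pose U := kermx (rowsub ev W).
pose F : 'M[R]_(#|S|, k.+1 + 1) := row_mx (colsub f (rowsub ev V)) (const_mx 1).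
have : kermx (U *m F)^T != 0.
  rewrite -mxrank_eq0 mxrank_ker subn_eq0 -ltnNge mxrank_tr.
  rewrite (leq_ltn_trans (mxrankM_maxl _ _)) // mxrank_ker rk.
  by rewrite addn1 ltnS leq_subLR addnC.
case/rowV0Pn => h /sub_kermxP hUF hn0.
exists (fun i => h 0 (lshift 1 i)); exists (h 0 (rshift k.+1 0)); split.
  have /rV0Pn[i hi] := hn0; case: (split_ordP i) hi => j -> hj.
    by left; exists j.
  by right; rewrite (ord1 j) in hj.
move=> t tS tW t1.
pose tS' := colsub ev t.
have reidx (G : 'I_N -> R) : (forall v, v \notin S -> G v = 0) ->
    \sum_v G v = \sum_(i < #|S|) G (ev i).
  move=> G0; rewrite (bigID (mem S)) /= [X in _ + X]big1 ?addr0 //.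
  by rewrite big_enum_val.
have : (tS' <= U)%MS.
  apply/sub_kermxP/rowP => j; rewrite !mxE.
  have := congr1 (fun x : 'rV_c => x 0 j) tW; rewrite !mxE => tWj.
  rewrite -[RHS]tWj reidx; first by apply: eq_bigr => i _; rewrite !mxE.
  by move=> v /tS ->; rewrite mul0r.
case/submxP => s sU.
have : tS' *m F *m h^T = 0.
  have UF : U *m F *m h^T = 0.
    by apply: (can_inj (@trmxK _ _ _)); rewrite trmx_mul trmxK hUF trmx0.
  by rewrite sU -(mulmxA s) -(mulmxA s) UF mulmx0.
move=> /(congr1 (fun x : 'M[R]_(1, 1) => x 0 0)); rewrite !mxE big_split_ord /= => tF0.
rewrite -[RHS]tF0; congr (_ + _).
  apply: eq_bigr => i _; rewrite !mxE; congr (_ * _).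
  rewrite reidx; last by move=> v /tS ->; rewrite mul0r.
  by apply: eq_bigr => v _; rewrite row_mxEl !mxE.
rewrite big_ord1 !mxE (_ : \sum_v tS' 0 v * F v (rshift k.+1 0) = 1) ?mul1r //.
rewrite -t1 reidx //; apply: eq_bigr => v _.
by rewrite row_mxEr !mxE mulr1.
Qed.

(** Translating the grid by the multiples of [eps / D.+1] gives [D.+1] disjoint
neighbourhoods of grids, and each of the at most [D] points meets only one. *)
Lemma clear_slots (R : realType) (I : finType) (P : I -> R) (eps eta : R) (D : nat) :
  (#|I| <= D)%N -> 0 < eps -> 4 * eta * D.+1%:R <= eps ->
  exists t : R, forall i (z : int), 2 * eta <= `|P i - (t + eps * z%:~R)|.
Proof.
move=> ID e0 small; apply: contrapT => none.
pose tau (s : 'I_D.+1) : R := eps * s%:R / D.+1%:R.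
have D0 : 0 < D.+1%:R :> R by [].
have /choice[f fP] : forall s : 'I_D.+1, exists i : I,
    exists z : int, `|P i - (tau s + eps * z%:~R)| < 2 * eta.
  move=> s; apply: contrapT => nf; apply: none; exists (tau s) => i z.
  by rewrite leNgt; apply/negP => lt; apply: nf; exists i, z.
have f_inj : injective f.
  move=> s s' fs; have [z lz] := fP s; have [z' lz'] := fP s'.
  rewrite -fs in lz'; apply/val_inj/eqP; apply: contraT => ne.
  pose q : int := (s%:Z - s'%:Z) + D.+1%:Z * (z - z').
  have q0 : q != 0.
    apply: contraNneq ne; rewrite /q => qe; apply/eqP.
    change (nat_of_ord s = nat_of_ord s').
    move: (ltn_ord s) (ltn_ord s') qe; generalize (z - z').
    move: (nat_of_ord s) (nat_of_ord s') => a a' y la la' qe.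
    have [y0|[y1|y1]] : y = 0 \/ y >= 1 \/ y <= -1 by lia.
    - by move: qe; rewrite y0; lia.
    - have : D.+1%:Z <= D.+1%:Z * y by rewrite ler_peMr.
      by lia.
    - have : D.+1%:Z <= D.+1%:Z * - y by rewrite ler_peMr // lerNr.
      by lia.
  have : eps / D.+1%:R * `|q%:~R| < 4 * eta.
    have -> : eps / D.+1%:R * `|q%:~R| =
        `|(P (f s) - (tau s' + eps * z'%:~R)) - (P (f s) - (tau s + eps * z%:~R))|.
      rewrite -[eps / _]ger0_norm ?divr_ge0 ?(ltW e0) // -normrM; congr `|_|.
      rewrite /q /tau rmorphD rmorphM !rmorphB /= !pmulrn; field.
      by rewrite pmulrn gt_eqF.
    by rewrite (le_lt_trans (ler_normB _ _)) //; lra.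
  apply: contraTT => _; rewrite -leNgt.
  have : 1 <= `|q%:~R| :> R.
    by rewrite -intr_norm ler1z; move: q0; rewrite -normr_gt0; lia.
  move=> q1; apply: (@le_trans _ _ (eps / D.+1%:R)).
    by rewrite ler_pdivlMr.
  by rewrite ler_peMr // divr_ge0 // ltW.
have := leq_card _ f_inj; rewrite card_ord => /leq_trans /(_ ID).
by rewrite ltnn.
Qed.

(** Countably many nonzero polynomials have countably many roots, and an interval
is uncountable. *)
Lemma avoid_roots (R : realType) (L : countType) (q : L -> {poly R}) (eta : R) :
  0 < eta -> (forall l, q l != 0) ->
  exists2 theta, 0 < theta < eta & forall l, ~~ root (q l) theta.
Proof.
move=> eta0 q0; apply: contrapT => none.
have cZ : countable (\bigcup_(l in [set: L]) [set x | root (q l) x]).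
  apply: bigcup_countable => // l _; apply: finite_set_countable.
  pose rs := [set x | root (q l) x].
  apply/finite_seqP.
  have [s sP] : exists s : seq R, forall x, root (q l) x -> x \in s.
    apply: contrapT => ns.
    have H k : exists s : seq R, [/\ size s = k, uniq s & all (root (q l)) s].
      elim: k => [|k [s [sk us rs']]]; first by exists [::].
      have [x xP] : exists x, root (q l) x /\ x \notin s.
        apply: contrapT => nx; apply: ns; exists s => x rx.
        by apply: contrapT => /negP xs; apply: nx; exists x.
      by exists (x :: s); split => /=; rewrite ?sk ?xP.1 ?xP.2.
    have [s [ss us rs']] := H (size (q l)).
    by have := max_poly_roots (q0 l) rs' us; rewrite ss ltnn.
  exists [seq x <- s | root (q l) x]; apply/seteqP; split => x /=.
    by move=> rx; rewrite mem_filter rx sP.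
  by rewrite mem_filter => /andP[].
have /countable_lebesgue_measure0 : countable `]0, eta[%classic.
  apply: sub_countable cZ; apply: subset_card_le => x /=.
  rewrite in_itv /= => x0; apply: contrapT => nx; apply: none.
  exists x => // l; apply/negP => rl; apply: nx; by exists l.
rewrite lebesgue_measure_itv /= lte_fin eta0 oppr0 adde0 => /eqP.
by rewrite eqe gt_eqF.
Qed.

(** The translation is [t0 a + theta ^+ a.+1]. The choice of [t0] keeps the grid
away from the vertices in [Y], hence from all simplices not in general position
with respect to the plane, since each has a vertex in [Y]. On a simplex in
general position, a point with [k + 1] grid coordinates makes [theta] a root of
a nonzero polynomial: distinct coordinates carry distinct powers of [theta] in
the equation of the hyperplane of [slice_functional]. *)
Lemma slice_grid (R : realType) (N m c k : nat) (V : 'M[R]_(N, m))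
    (B : 'M[R]_(m, c)) (b : 'rV[R]_c) (Y : {set 'I_N}) (eps eta : R) (D : nat) :
  (#|Y| <= D)%N -> 0 < eps -> 0 < eta -> eta <= 1 -> 4 * eta * D.+1%:R <= eps ->
  (forall A : {set 'I_N}, (#|A| <= c)%N -> dependent (offset V B b) A -> ~~ [disjoint A & Y]) ->
  exists t : 'rV[R]_m, forall x, star_complex V (k + c) eta x -> x *m B = b ->
    (#|grid_coords eps t x| <= k)%N.
Proof.
move=> YD eps0 eta0 eta1 small hitY.
have /choice[t0 t0P] : forall a : 'I_m, exists t : R, forall (v : {v | v \in Y}) (z : int),
    2 * eta <= `|V (val v) a - (t + eps * z%:~R)|.
  move=> a; apply: (@clear_slots _ _ (fun v : {v | v \in Y} => V (val v) a) _ _ D) => //.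
  by rewrite card_sig.
pose L : countType := ({set 'I_N} * {ffun 'I_k.+1 -> 'I_m} * {ffun 'I_k.+1 -> int})%type.
have /choice[q qP] : forall l : L, exists q : {poly R}, q != 0 /\
    forall (theta : R) (t : 'rV[R]_N),
      (#|l.1.1| <= k.+1 + c)%N ->
      \rank (rowsub (@enum_val _ (mem l.1.1)) (offset V B b)) = c ->
      injective l.1.2 ->
      (forall v, v \notin l.1.1 -> t 0 v = 0) -> t *m offset V B b = 0 ->
      \sum_v t 0 v = 1 ->
      (forall i, (t *m V) 0 (l.1.2 i) =
         t0 (l.1.2 i) + theta ^+ (l.1.2 i).+1 + eps * (l.2 i)%:~R) ->
      root q theta.
  move=> [[S f] z] /=.
  have [[Sk rk f_inj]|nh] := pselect [/\ (#|S| <= k.+1 + c)%N,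
    \rank (rowsub (@enum_val _ (mem S)) (offset V B b)) = c & injective f]; last first.
    exists 1; rewrite oner_eq0; split => // theta t Sk rk f_inj.
    by case: nh.
  have [h [h0 [hn0 hP]]] := @slice_functional _ _ _ _ _ V _ _ f Sk rk.
  pose q : {poly R} := \sum_i h i *: 'X^((f i).+1) +
    (\sum_i (t0 (f i) + eps * (z i)%:~R) * h i + h0)%:P.
  exists q; split.
    have [/forallP hz|/forallPn[i hi]] := boolP [forall i, h i == 0].
      have h00 : h0 != 0.
        by case: hn0 => // -[i]; rewrite (eqP (hz i)) eqxx.
      rewrite /q big1 ?add0r; last by move=> i _; rewrite (eqP (hz i)) scale0r.
      rewrite big1 ?add0r ?polyC_eq0 //.
      by move=> i _; rewrite (eqP (hz i)) mulr0.
    apply: contraNneq hi => qz; have := congr1 (fun p : {poly R} => p`_((f i).+1)) qz.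
    rewrite coef0 coefD coefC /= addr0 coef_sum (bigD1 i) //= big1.
      by rewrite coefZ coefXn eqxx mulr1 addr0 => ->.
    move=> j ji; rewrite coefZ coefXn eqSS; case: eqP; rewrite ?mulr0 //.
    by move=> /val_inj/f_inj ij; rewrite ij eqxx in ji.
  move=> theta t _ _ _ tS tW t1 xP.
  rewrite rootE /q hornerD hornerC horner_sum addrA -big_split /=.
  rewrite -[X in _ == X](hP t tS tW t1); apply/eqP; congr (_ + _).
  apply: eq_bigr => i _; rewrite xP hornerZ hornerXn; ring.
have [theta /andP[th0 th1] thP] := @avoid_roots _ L q eta eta0 (fun l => (qP l).1).
exists (\row_a (t0 a + theta ^+ a.+1)) => x [t [t_ge0 t1 tk tV xV]] xB.
pose S : {set 'I_N} := [set v | t 0 v != 0]%SET.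
have tn0 : t != 0.
  by apply: contra_eq_neq t1 => ->; rewrite big1 ?(eq_sym 0) ?oner_neq0 // => v _; rewrite mxE.
have St v : (v \in S) = (t 0 v != 0) by rewrite finset.inE.
have tW : t *m offset V B b = 0.
  apply/rowP => j; rewrite !mxE.
  have := congr1 (fun y : 'rV_c => y 0 j) xB; rewrite xV -mulmxA mxE => e.
  under eq_bigr => v _ do rewrite mxE mulrBr.
  by rewrite sumrB e -mulr_suml t1 mul1r subrr.
have Sk : (#|S| <= k.+1 + c)%N by rewrite cardsE addSn.
have := rank_leq_col (rowsub (@enum_val _ (mem S)) (offset V B b)).
rewrite leq_eqVlt => /orP[/eqP rk|rk]; last first.
  have [A [AS Ac dA]] := rank_defect_dependent St tn0 tW rk.
  have := hitY _ Ac dA; rewrite -setI_eq0 => /finset.set0Pn[v].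
  rewrite finset.in_setI => /andP[vA vY].
  have tv : t 0 v != 0 by rewrite -St (fintype.subsetP AS).
  suff -> : grid_coords eps (\row_a (t0 a + theta ^+ a.+1)) x = finset.set0 by rewrite cards0.
  apply/finset.setP => a; rewrite !finset.inE; apply/asboolP => -[z].
  rewrite mxE => xa.
  have : `|x 0 a - V v a| <= eta.
    have -> : x 0 a - V v a = \sum_w t 0 w * (V w a - V v a).
      rewrite (eq_bigr (fun w => t 0 w * V w a - t 0 w * V v a)); last first.
        by move=> w _; rewrite mulrBr.
      by rewrite sumrB -mulr_suml t1 mul1r xV mxE.
    rewrite (le_trans (ler_norm_sum _ _ _)) // -[eta]mul1r -t1 mulr_suml.
    apply: ler_sum => w _; rewrite normrM ger0_norm ?t_ge0 //.
    have [->|tw] := eqVneq (t 0 w) 0; first by rewrite !mul0r.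
    by rewrite ler_wpM2l ?t_ge0 // tV.
  have := t0P a (exist _ v vY) z; rewrite /= xa.
  have th2 : 0 <= theta ^+ a.+1 < eta.
    rewrite exprn_ge0 ?(ltW th0) //= exprS (le_lt_trans _ th1) //.
    by rewrite ger_pMr // exprn_ile1 ?(ltW th0) // (le_trans (ltW th1)).
  move: th2; rewrite ler_norml => /andP[q1 q2] lb /andP[lb1 lb2].
  move: lb; rewrite leNgt => /negP; apply; rewrite ltr_norml.
  by apply/andP; split; lra.
rewrite leqNgt; apply/negP => gk.
pose f : {ffun 'I_k.+1 -> 'I_m} := [ffun i => enum_val (widen_ord gk i)].
have f_inj : injective f.
  by move=> i j; rewrite !ffunE => /enum_val_inj /(congr1 val) /= /val_inj.
have /choice[z zP] : forall i, exists z : int,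
    x 0 (f i) = (\row_a (t0 a + theta ^+ a.+1)) 0 (f i) + eps * z%:~R.
  move=> i; have := enum_valP (widen_ord gk i); rewrite finset.inE => /asboolP.
  by rewrite ffunE.
pose l : L := (S, f, [ffun i => z i]).
have : root (q l) theta; last exact/negP.
apply: ((qP l).2 theta t) => //=.
- by move=> v; rewrite St negbK => /eqP.
- by move=> i; rewrite -xV zP mxE [in RHS](ffunE z).
Qed.

(** * Covering dimension from grids *)

Lemma nbhs_mxP (R : realType) (m n : nat) (x : 'M[R]_(m, n)) (A : set 'M[R]_(m, n)) :
  nbhs x A <-> exists2 e : R, 0 < e &
    forall y : 'M[R]_(m, n), (forall i j, `|x i j - y i j| < e) -> A y.
Proof.
split=> [/nbhs_ballP[e /= e0 eA]|[e e0 eA]].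
  by exists e => // y xy; apply: eA; split.
by apply/nbhs_ballP; exists e => //= y [_ xy]; apply: eA.
Qed.

Lemma nbhs_mx_box (R : realType) (m n : nat) (x : 'M[R]_(m, n)) (e : R) :
  0 < e -> nbhs x [set y : 'M[R]_(m, n) | forall i j, `|x i j - y i j| < e].
Proof. by move=> e0; apply/nbhs_mxP; exists e. Qed.

(** Points whose coordinates in [I] are close to the integers [z], compared with
the distance to the integers of the other coordinates, which lie strictly
between [z] and [z + 1]. For [b] in the unit interval, [1 / 2 - `|b - 1 / 2|]
is the distance of [b] to the integers. *)
Definition grid_cell (R : realType) (m : nat) (I : {set 'I_m}) (z : 'I_m -> int)
    (y : 'I_m -> R) : Prop :=
  [/\ forall a, a \in I -> `|y a - (z a)%:~R| < 1 / 2,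
      forall b, b \notin I -> `|y b - (z b)%:~R - 1 / 2| < 1 / 2 &
      forall a b, a \in I -> b \notin I ->
        `|y a - (z a)%:~R| + `|y b - (z b)%:~R - 1 / 2| < 1 / 2].


Lemma intr_dist_lt1 (R : realType) (p q : int) : `|p%:~R - q%:~R| < 1 :> R -> p = q.
Proof.
rewrite -rmorphB /= -intr_norm ltrz1 => pq; apply/eqP; rewrite -subr_eq0.
by rewrite -normr_eq0; have := normr_ge0 (p - q); lia.
Qed.

(** Cells with the same number of close coordinates are disjoint, since [I] must
consist of the [#|I|] coordinates that are closest to the integers. *)
Lemma grid_cell_unique (R : realType) (m : nat) (I I' : {set 'I_m})
    (z z' : 'I_m -> int) (y : 'I_m -> R) :
  grid_cell I z y -> grid_cell I' z' y -> #|I| = #|I'| -> I = I' /\ z =1 z'.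
Proof.
have aux J J' u u' : grid_cell J u y -> grid_cell J' u' y -> forall a b,
    a \in J -> a \notin J' -> b \in J' -> b \notin J ->
    `|y a - (u a)%:~R| < `|y b - (u' b)%:~R|.
  move=> [_ J2 J3] _ a b aJ _ bJ' bJ; have := J3 _ _ aJ bJ; have := J2 _ bJ.
  rewrite ltr_norml => /andP[h1 h2] h3; rewrite ltNge; apply/negP => h4.
  have [ub|ub] : u' b <= u b \/ u b + 1 <= u' b by lia.
    move: ub; rewrite -(ler_int R) => ub.
    have : `|y b - (u' b)%:~R| = y b - (u' b)%:~R by rewrite ger0_norm //; lra.
    have := ler_norm (- (y b - (u b)%:~R - 1 / 2)); rewrite normrN; lra.
  move: ub; rewrite -(ler_int R) rmorphD /= => ub.
  have : `|y b - (u' b)%:~R| = (u' b)%:~R - y b by rewrite ler0_norm ?opprB //; lra.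
  have := ler_norm (y b - (u b)%:~R - 1 / 2); lra.
move=> c c' ceq.
have II' : I = I'.
  apply/eqP; rewrite eqEcard ceq leqnn andbT; apply/fintype.subsetP => a aI.
  apply: contraT => aI'.
  have [b bI' bI] : exists2 b, b \in I' & b \notin I.
    apply/subsetPn; apply: contra aI' => sub.
    by have /eqP -> : I' == I by rewrite eqEcard sub ceq leqnn.
  have := aux _ _ _ _ c c' a b aI aI' bI' bI.
  by move/lt_trans => /(_ _ (aux _ _ _ _ c' c b a bI' bI aI aI')); rewrite ltxx.
split=> // a; move: c c' => [c1 c2 _] [c1' c2' _]; apply: (@intr_dist_lt1 R).
have [aI|aI] := boolP (a \in I).
  have := c1 _ aI; have := c1' a; rewrite -II' => /(_ aI).
  by rewrite !ltr_norml => /andP[? ?] /andP[? ?]; apply/andP; split; lra.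
have := c2 _ aI; have := c2' a; rewrite -II' => /(_ aI).
by rewrite !ltr_norml => /andP[? ?] /andP[? ?]; apply/andP; split; lra.
Qed.

Lemma grid_cell_floor (R : realType) (m : nat) (y : 'I_m -> R) (I : {set 'I_m}) :
  (forall a, (a \in I) = `[< exists z : int, y a = z%:~R >]) ->
  grid_cell I (fun a => Num.floor (y a)) y.
Proof.
move=> IP.
have H1 a : a \in I -> y a - (Num.floor (y a))%:~R = 0.
  by rewrite IP => /asboolP[z ->]; rewrite intrKfloor subrr.
have H2 b : b \notin I -> `|y b - (Num.floor (y b))%:~R - 1 / 2| < 1 / 2.
  rewrite IP => /asboolP nz.
  have := floor_itv (y b); rewrite rmorphD /= le_eqVlt => /andP[/orP[/eqP e|lt] lt'].
    by exfalso; apply: nz; exists (Num.floor (y b)).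
  by rewrite ltr_norml; apply/andP; split; lra.
split=> [a aI|//|a b aI bI]; first by rewrite H1 // normr0.
by rewrite H1 // normr0 add0r H2.
Qed.

Lemma grid_cell_diam (R : realType) (m : nat) (y y' : 'I_m -> R) (I : {set 'I_m}) z :
  grid_cell I z y -> grid_cell I z y' -> forall a, `|y a - y' a| < 1.
Proof.
move=> [c1 c2 _] [c1' c2' _] a; have [aI|aI] := boolP (a \in I).
  have := c1 _ aI; have := c1' _ aI.
  by rewrite !ltr_norml => /andP[? ?] /andP[? ?]; apply/andP; split; lra.
have := c2 _ aI; have := c2' _ aI.
by rewrite !ltr_norml => /andP[? ?] /andP[? ?]; apply/andP; split; lra.
Qed.

Lemma grid_cell_open (R : realType) (m : nat) (I : {set 'I_m}) (z : 'I_m -> int)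
    (t : 'rV[R]_m) (eps : R) : 0 < eps ->
  open [set x : 'rV[R]_m | grid_cell I z (fun a => (x 0 a - t 0 a) / eps)].
Proof.
move=> eps0; rewrite openE => x [h1 h2 h3].
pose Y (y : 'rV[R]_m) a : R := (y 0 a - t 0 a) / eps.
pose d (y : 'rV[R]_m) a : R := `|Y y a - (z a)%:~R|.
pose d' (y : 'rV[R]_m) a : R := `|Y y a - (z a)%:~R - 1 / 2|.
have base (s : R) a : 0 < s -> \forall y \near x, `|Y y a - Y x a| < s.
  move=> s0; apply/nbhs_mxP; exists (s * eps) => [|y xy]; first by rewrite mulr_gt0.
  rewrite /Y -mulrBl opprB addrA subrK normrM [`|eps^-1|]gtr0_norm ?invr_gt0 //.
  by rewrite ltr_pdivrMr // distrC.
have trn (u v w : R) : `|u - w| <= `|v - w| + `|u - v|.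
  by rewrite [leRHS]addrC ler_distD.
have cd a (s : R) : d x a < s -> \forall y \near x, d y a < s.
  move=> ds; have := @base (s - d x a) a; rewrite subr_gt0 => /(_ ds); apply: filterS => y.
  by rewrite ltrBrDl; apply: le_lt_trans; exact: trn.
have cd' a (s : R) : d' x a < s -> \forall y \near x, d' y a < s.
  move=> ds; have := @base (s - d' x a) a; rewrite subr_gt0 => /(_ ds); apply: filterS => y.
  rewrite ltrBrDl; apply: le_lt_trans; rewrite /d' -!addrA -!opprD; exact: trn.
have n1 : \forall y \near x, forall a, a \in I -> d y a < 1 / 2.
  apply: (@filter_forall 'rV[R]_m 'I_m (fun a y => a \in I -> d y a < 1 / 2) (nbhs x) _) => a; have [aI|_] := boolP (a \in I); last exact: nearW.
  by have := cd _ _ (h1 _ aI); apply: filterS.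
have n2 : \forall y \near x, forall a, a \notin I -> d' y a < 1 / 2.
  apply: (@filter_forall 'rV[R]_m 'I_m (fun a y => a \notin I -> d' y a < 1 / 2) (nbhs x) _) => a; have [_|aI] := boolP (a \in I); first exact: nearW.
  by have := cd' _ _ (h2 _ aI); apply: filterS.
have n3 : \forall y \near x, forall a, forall b, a \in I -> b \notin I ->
    d y a + d' y b < 1 / 2.
  apply: (@filter_forall 'rV[R]_m 'I_m (fun a y => forall b, a \in I -> b \notin I ->
    d y a + d' y b < 1 / 2) (nbhs x) _) => a.
  apply: (@filter_forall 'rV[R]_m 'I_m (fun b y => a \in I -> b \notin I ->
    d y a + d' y b < 1 / 2) (nbhs x) _) => b.
  have [aI|_] := boolP (a \in I); last exact: nearW.
  have [_|bI] := boolP (b \in I); first exact: nearW.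
  pose s := (1 / 2 - (d x a + d' x b)) / 2.
  have s0 : 0 < s by have := h3 _ _ aI bI; rewrite /s /d /d' /Y; lra.
  have := cd a (d x a + s); rewrite ltrDl => /(_ s0).
  have := cd' b (d' x b + s); rewrite ltrDl => /(_ s0).
  by apply: filterS2 => y yb ya _ _; move: ya yb; rewrite /s; lra.
rewrite /interior; near=> y; split.
- by near: y.
- by near: y.
- by near: y.
Unshelve. all: by end_near. Qed.

Lemma compact_coord_bounded (R : realType) (m : nat) (K : set 'rV[R]_m) :
  compact K -> exists M : R, forall x, K x -> forall a, `|x 0 a| <= M.
Proof.
move=> /compact_near_coveringP cK.
pose P (M : R) (x : 'rV[R]_m) := forall a, `|x 0 a| <= M.
have : \forall M \near +oo%R, K `<=` P M.
  apply: cK.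
  move=> x _; pose M0 : R := 1 + \sum_a `|x 0 a|.
  exists ([set x' : 'rV[R]_m | forall i a, `|x i a - x' i a| < 1], [set M : R | M0 <= M]).
    split; last by apply: nbhs_pinfty_ge; exact: num_real.
    by apply/nbhs_mxP; exists 1.
  move=> [x' M] /= [xx' MM] a; apply: le_trans MM.
  have le1 : `|x 0 a| <= \sum_a `|x 0 a| by rewrite (bigD1 a) //= lerDl sumr_ge0.
  have := xx' 0 a; rewrite distrC => /ltW lt1.
  rewrite -[x' 0 a](subrK (x 0 a)) (le_trans (ler_normD _ _)) // /M0 lerD //.
move=> [M [_ MP]]; exists (M + 1) => x Kx; apply: MP => //.
by rewrite ltrDl.
Qed.

Lemma lebesgue_number (R : realType) (m : nat) (K : set 'rV[R]_m) (I : Type)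
    (U : I -> set (set_type K)) :
  compact K -> (forall i, open (U i)) -> \bigcup_i U i = [set: set_type K] ->
  exists2 e : R, 0 < e & forall x, K x -> exists i, forall y : set_type K,
    (forall a, `|x 0 a - set_val y 0 a| < e) -> U i y.
Proof.
move=> /compact_near_coveringP cK oU covU.
pose P (e : R) (x : 'rV[R]_m) := exists i, forall y : set_type K,
    (forall a, `|x 0 a - set_val y 0 a| < e) -> U i y.
suff : \forall e \near 0^'+, K `<=` P e.
  move=> H; have [e [e0 eP]] : exists e : R, 0 < e /\ K `<=` P e.
    have : \forall e \near 0^'+, 0 < e /\ K `<=` P e.
      by near=> e; split; [near: e; exact: nbhs_right_gt|near: e].
    by move=> /filter_ex.
  by exists e.
apply: cK => x Kx.
have [i _ Ui] : (\bigcup_i U i) (exist _ x (mem_set Kx)) by rewrite covU.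
have [W oW WU] := oU i.
have : nbhs x W.
  apply: open_nbhs_nbhs; split => //.
  by move: Ui; rewrite -WU.
move=> /nbhs_mxP[r r0 rW].
exists ([set x' : 'rV[R]_m | forall i a, `|x i a - x' i a| < r / 2], [set e : R | e < r / 2]).
  split; last by apply: nbhs_right_lt; rewrite divr_gt0.
  by apply/nbhs_mxP; exists (r / 2) => //; rewrite divr_gt0.
move=> [x' e] /= [xx' er]; exists i => y xy; rewrite -WU; apply: rW => j a.
rewrite !ord1; have := ler_distD (x' 0 a) (x 0 a) (set_val y 0 a).
by have := xy a; have := xx' 0 a; lra.
Unshelve. all: by end_near. Qed.

(** The cells with [i] close coordinates form a disjoint family of small open sets
for each [i], and a point with at most [k] grid coordinates lies in a cell with
[i <= k]; so every point is in at most [k + 1] of these cells. *)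
Lemma dim_le_grid (R : realType) (m k : nat) (K : set 'rV[R]_m) :
  compact K ->
  (forall e : R, 0 < e -> exists2 eps : R, 0 < eps <= e &
     exists t : 'rV[R]_m, forall x, K x -> (#|grid_coords eps t x| <= k)%N) ->
  dim_le (set_type K) k%:Z.
Proof.
move=> cK grid; split; first by lia.
move=> I U oU covU.
have [[x0 Kx0]|nK] := pselect (K !=set0); last first.
  have noK (x : set_type K) : False by apply: nK; exists (set_val x); exact: set_valP.
  exists 'I_0, (fun=> set0); split; [by case|idtac|by case|by move=> x; case: (noK x)].
  by apply/seteqP; split => // x; case: (noK x).
have [e1 e10 leb1] := lebesgue_number cK oU covU.
have [M MP] := compact_coord_bounded cK.
have [e /andP[e0 ee1] [t tP]] := grid e1 e10.
have leb x : K x -> exists i, forall y : set_type K,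
    (forall a, `|x 0 a - set_val y 0 a| < e) -> U i y.
  move=> /leb1[i iP]; exists i => y xy; apply: iP => a.
  exact: lt_le_trans (xy a) ee1.
pose y (x : 'rV[R]_m) a : R := (x 0 a - t 0 a) / e.
have [Z ZP] : exists Z : nat, forall x, K x -> forall a, `|y x a| < Z%:R.
  exists (Num.bound ((M + \sum_a `|t 0 a|) / e)) => x Kx a.
  apply: le_lt_trans (archi_boundP _); last first.
    apply: divr_ge0; last exact: ltW.
    by rewrite addr_ge0 ?sumr_ge0 // (le_trans _ (MP _ Kx a)).
  rewrite normrM [`|e^-1|]gtr0_norm ?invr_gt0 // ler_pM2r ?invr_gt0 //.
  rewrite (le_trans (ler_normB _ _)) // lerD ?MP //.
  by rewrite (bigD1 a) //= lerDl sumr_ge0.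
pose J : finType := ({set 'I_m} * {ffun 'I_m -> 'I_(Z.+1 + Z.+1)})%type.
pose dec (j : J) (a : 'I_m) : int := (j.2 a : nat)%:Z - Z.+1%:Z.
pose V (j : J) : set (set_type K) :=
  set_val @^-1` [set x | (#|j.1| <= k)%N /\ grid_cell j.1 (dec j) (y x)].
have diamV j x x' : V j x -> V j x' -> forall a, `|set_val x 0 a - set_val x' 0 a| < e.
  move=> [_ Vx] [_ Vx'] a; have := grid_cell_diam Vx Vx' a.
  rewrite /y -mulrBl opprB addrA subrK normrM [`|e^-1|]gtr0_norm ?invr_gt0 //.
  by rewrite ltr_pdivrMr // mul1r.
exists J, V; split.
- move=> j; have [jk|jk] := boolP (#|j.1| <= k)%N.
    exists [set x | grid_cell j.1 (dec j) (y x)]; first exact: grid_cell_open.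
    by apply/seteqP; split => x /= [].
  have -> : V j = set0 by apply/seteqP; split => // x [/= jk']; rewrite jk' in jk.
  exact: open0.
- apply/seteqP; split => // x _.
  have Kx := set_valP x.
  have fl a : (0 <= Num.floor (y (set_val x) a) + Z.+1%:Z)%R /\
      (`|(Num.floor (y (set_val x) a) + Z.+1%:Z)%R| < Z.+1 + Z.+1)%N.
    have := ZP _ Kx a; rewrite ltr_norml => /andP[l1 l2].
    have f1 : (- Z%:Z <= Num.floor (y (set_val x) a))%R.
      by rewrite floor_ge_int rmorphN /= ltW.
    have f2 : (Num.floor (y (set_val x) a) < Z%:Z)%R by rewrite floor_lt_int.
    by split; lia.
  pose j : J := (grid_coords e t (set_val x),
    [ffun a => Ordinal (fl a).2]).
  exists j => //; split; first exact: tP.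
  have -> : dec j = fun a => Num.floor (y (set_val x) a).
    by apply/funext => a; rewrite /dec ffunE /= gez0_abs ?(fl a).1 // addrK.
  apply: grid_cell_floor => a; rewrite finset.inE; apply/asboolP/asboolP => -[z zP]; exists z.
    by rewrite /y zP addrC addKr mulrC mulKf // gt_eqF.
  by move: zP; rewrite /y => <-; rewrite mulrC divfK ?gt_eqF // addrC subrK.
- move=> j; have [[x Vx]|nV] := pselect (V j !=set0).
    have [i iP] := leb _ (set_valP x).
    by exists i => x' Vx'; apply: iP; exact: diamV Vx Vx'.
  have [i _] : (\bigcup_i U i) (exist _ x0 (mem_set Kx0)) by rewrite covU.
  by exists i => x Vx; case: nV; exists x.
- move=> x; have -> : k%:Z + 1 = k.+1%:Z by lia.
  rewrite lez_nat.
  pose A := [set j : J | x \in V j]%SET.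
  have -> : #|[pred j | x \in V j]| = #|A| by rewrite cardsE.
  pose f (j : J) : 'I_k.+1 := inord #|j.1|.
  have fA : {in A &, injective f}.
    move=> j j'; rewrite !finset.in_set => /set_mem[jk Vj] /set_mem[jk' Vj'].
    move=> /(congr1 val) /=; rewrite !inordK ?ltnS // => cjj'.
    have [eI ez] := grid_cell_unique Vj Vj' cjj'.
    rewrite [j]surjective_pairing [j']surjective_pairing eI; congr (_, _).
    apply/ffunP => a; apply/val_inj => /=; have := ez a; rewrite /dec.
    by move=> /addIr [].
  by rewrite -(card_in_imset fA) -[leqRHS]card_ord max_card.
Qed.

(** * Stability under perturbation *)

(** The property of a compact set that makes its slices by all planes of
codimension [c] at most [k]-dimensional at scale [eps]. *)
Definition grid_thin (R : realType) (m c k : nat) (eps : R) (K : set 'rV[R]_m) :=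
  forall (B : 'M[R]_(m, c)) (b : 'rV[R]_c), normalized B ->
  exists t : 'rV[R]_m, forall x, K x -> x *m B = b ->
    (#|grid_coords eps t x| <= k)%N.

Lemma grid_coords_near (R : realType) (m : nat) (eps : R) (t x : 'rV[R]_m) :
  0 < eps -> \forall y \near x, grid_coords eps t y \subset grid_coords eps t x.
Proof.
move=> eps0.
have : \forall y \near x, forall a, a \in grid_coords eps t y -> a \in grid_coords eps t x.
  apply: (@filter_forall 'rV[R]_m 'I_m (fun a y => a \in grid_coords eps t y ->
    a \in grid_coords eps t x) (nbhs x) _) => a.
  have [aI|aI] := boolP (a \in grid_coords eps t x); first exact: nearW.
  pose u := (x 0 a - t 0 a) / eps; pose w := Num.floor u.
  have xE : x 0 a = t 0 a + eps * u.
    by rewrite /u mulrC divfK ?gt_eqF // addrC subrK.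
  have [u1 u2] : w%:~R < u /\ u < w%:~R + 1.
    have := floor_itv u; rewrite rmorphD /= le_eqVlt => /andP[/orP[/eqP uw|//] _].
    move: aI; rewrite finset.inE => /asboolP; case; exists w.
    by rewrite xE -uw.
  have [s s0 [su1 su2]] : exists2 s, 0 < s & w%:~R + s <= u /\ u + s <= w%:~R + 1.
    exists (Num.min (u - w%:~R) (w%:~R + 1 - u)).
      by rewrite lt_min !subr_gt0 u1.
    split.
      by rewrite addrC -lerBrDr ge_min lexx.
    by rewrite addrC -lerBrDr ge_min lexx orbT.
  apply/nbhs_mxP; exists (eps * s); first exact: mulr_gt0.
  move=> y xy; rewrite finset.inE => /asboolP[z yE]; exfalso.
  have := xy 0 a; rewrite xE yE opprD addrACA subrr add0r -mulrBr normrM gtr0_norm //.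
  rewrite ltr_pM2l // ltr_norml => /andP[h1 h2].
  have [zw|zw] : z <= w \/ w + 1 <= z by lia.
    by move: zw; rewrite -(ler_int R); lra.
  by move: zw; rewrite -(ler_int R) rmorphD /=; lra.
by apply: filterS => y yP; apply/fintype.subsetP.
Qed.

(** A grid that works for one plane works for all nearby planes and nearby sets,
because the points with more than [k] grid coordinates form a closed set. The
planes that meet a bounded set form a compact family, so one distance [d]
serves them all. *)
Lemma grid_thin_stable (R : realType) (m c k : nat) (eps M : R) (K : set 'rV[R]_m) :
  0 < eps -> closed K -> (forall x, K x -> forall a, `|x 0 a| <= M) ->
  grid_thin c k eps K ->
  exists2 d : R, 0 < d & forall K' : set 'rV[R]_m,
    (forall x, K' x -> exists2 y, K y & forall a, `|x 0 a - y 0 a| < d) ->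
    grid_thin c k eps K'.
Proof.
move=> eps0 clK KM thin.
pose C : R := 1 + `|M|.
have C0 : 0 < C by rewrite ltr_wpDr.
pose S : R := 1 + m%:R * C.
have S0 : 0 < S by rewrite ltr_wpDr // mulr_ge0 // ltW.
(* q in the cube [-1, 1]^(m c + c) codes the plane: its first m c entries are
   those of B outside the rows of the identity block, the others are b / S *)
pose Bq (f : {ffun 'I_c -> 'I_m}) (q : 'rV[R]_(m * c + c)) : 'M[R]_(m, c) :=
  \matrix_(a, j) if [pick i | f i == a] is Some i then (i == j)%:R
                 else q 0 (lshift c (mxvec_index a j)).
pose bq (q : 'rV[R]_(m * c + c)) : 'rV[R]_c := \row_j (S * q 0 (rshift (m * c) j)).
pose Q : set 'rV[R]_(m * c + c) := [set q | forall i, `[-1, 1]%classic (q 0 i)].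
pose P (f : {ffun 'I_c -> 'I_m}) (d : R) (q : 'rV[R]_(m * c + c)) :=
  injective f -> exists t : 'rV[R]_m, forall x : 'rV[R]_m, (forall a, `|x 0 a| <= C) ->
    (exists2 y, K y & forall a, `|x 0 a - y 0 a| < d) ->
    x *m Bq f q = bq q -> (#|grid_coords eps t x| <= k)%N.
have QP q : Q q <-> forall i, `|q 0 i| <= 1.
  by split=> H i; have := H i; rewrite /= in_itv /= ler_norml.
suff main f : \forall d \near 0^'+, Q `<=` P f d.
  have : \forall d \near 0^'+, [/\ 0 < d, d < 1 & forall f, Q `<=` P f d].
    near=> d; split.
    - near: d; exact: nbhs_right_gt.
    - near: d; exact: nbhs_right_lt.
    near: d.
    exact: (@filter_forall R {ffun 'I_c -> 'I_m} (fun f d => Q `<=` P f d) _ _).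
  move=> /filter_ex[d [d0 d1 dP]]; exists d => // K' K'K B b [B1 [f Bf]].
  have f_inj := dual_family_inj Bf.
  have K'C x : K' x -> forall a, `|x 0 a| <= C.
    move=> /K'K[y Ky xy] a; rewrite -[x 0 a](subrK (y 0 a)).
    rewrite (le_trans (ler_normD _ _)) // lerD //.
      by rewrite (le_trans (ltW (xy a))) // ltW.
    by rewrite (le_trans (KM _ Ky a)) // ler_norm.
  have [[x [K'x xB]]|none] := pselect (exists x, K' x /\ x *m B = b); last first.
    by exists 0 => x K'x xB; case: none; exists x.
  have bS j : `|b 0 j| <= S.
    rewrite -xB mxE (le_trans (ler_norm_sum _ _ _)) //.
    rewrite (@le_trans _ _ (\sum_(a < m) C)) //.
      apply: ler_sum => a _; rewrite normrM -[C]mulr1 ler_pM // ?B1 //.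
      exact: K'C.
    by rewrite sumr_const card_ord -mulr_natl /S; lra.
  pose q : 'rV[R]_(m * c + c) := row_mx (mxvec B) (S^-1 *: b).
  have Qq : Q q.
    apply/QP => i; rewrite /q; case: (split_ordP i) => j ->.
      by rewrite row_mxEl; case/mxvec_indexP: j => a j; rewrite mxvecE.
    rewrite row_mxEr mxE normrM gtr0_norm ?invr_gt0 //.
    by rewrite mulrC ler_pdivrMr // mul1r.
  have BE : Bq [ffun i => f i] q = B.
    apply/matrixP => a j; rewrite mxE; case: pickP => [i|_].
      by rewrite ffunE => /eqP <-; rewrite Bf.
    by rewrite row_mxEl mxvecE.
  have bE : bq q = b.
    by apply/rowP => j; rewrite mxE row_mxEr mxE mulVKf // gt_eqF.
  have [|t tP] := dP [ffun i => f i] q Qq.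
    by move=> i j; rewrite !ffunE => /f_inj.
  exists t => x' K'x' x'B; apply: tP; first exact: K'C.
    exact: K'K.
  by rewrite BE bE.
have cQ : compact Q.
  apply: (@rV_compact R (m * c + c) (fun=> `[-1, 1]%classic)) => i; exact: segment_compact.
move/compact_near_coveringP : cQ; apply => q0 Qq0.
have [f_inj|nf_inj] := pselect (injective f); last first.
  by exists (setT, setT); [split; exact: filterT|move=> [q d] _ /nf_inj].
have nB : normalized (Bq f q0).
  split=> [a j|].
    rewrite mxE; case: pickP => [i _|_]; last exact: (iffLR (QP _) Qq0).
    by case: eqP; rewrite ?normr1 ?normr0.
  exists f => i j; rewrite mxE; case: pickP => [i' /eqP/f_inj -> //|/(_ i)].
  by rewrite eqxx.
have [t tP] := thin _ (bq q0) nB.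
pose P' (dq : 'rV[R]_(m * c + c) * R) (x : 'rV[R]_m) :=
  (exists2 y, K y & forall a, `|x 0 a - y 0 a| < dq.2) ->
    x *m Bq f dq.1 = bq dq.1 -> (#|grid_coords eps t x| <= k)%N.
pose Bx : set 'rV[R]_m := [set x | forall a, `[- C, C]%classic (x 0 a)].
have BxP x : Bx x <-> forall i, `|x 0 i| <= C.
  by split=> H i; have := H i; rewrite /= in_itv /= ler_norml.
have cBx : compact Bx by apply: (@rV_compact R m (fun=> `[- C, C]%classic)) => i; exact: segment_compact.
have : \forall dq \near (nbhs q0, 0^'+), Bx `<=` P' dq.
  move/compact_near_coveringP : cBx => cBx.
  apply: (cBx _ (filter_prod (nbhs q0) 0^'+) P' _) => x0 Bx0.
  have [few|many] := leqP #|grid_coords eps t x0| k.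
    exists ([set x | grid_coords eps t x \subset grid_coords eps t x0], setT).
      split; first exact: grid_coords_near.
      by exists (setT, setT); first by split; exact: filterT.
    move=> [x dq] /= [sub _] _ _; exact: leq_trans (subset_leq_card sub) few.
  have [Kx0|nKx0] := pselect (K x0); last first.
    have : nbhs x0 (~` K) by apply: open_nbhs_nbhs; split => //; exact: closed_openC.
    move=> /nbhs_mxP[r r0 rK].
    exists ([set x : 'rV[R]_m | forall i a, `|x0 i a - x i a| < r / 2],
       [set dq : 'rV[R]_(m * c + c) * R | dq.2 < r / 2]).
      split.
        by apply/nbhs_mxP; exists (r / 2) => //; rewrite divr_gt0.
      exists (setT, [set d : R | d < r / 2]).
        split; first exact: filterT.
        by apply: nbhs_right_lt; rewrite divr_gt0.
      by move=> [q d] /= [].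
    move=> [x [q d]] /= [xx0 dr] [y Ky xy] _; case: (rK y) => // i a.
    rewrite !ord1; have := ler_distD (x 0 a) (x0 0 a) (y 0 a).
    by have /= := xy a; have := xx0 0 a; lra.
  have [xB|xB] := pselect (x0 *m Bq f q0 = bq q0).
    by have := tP _ Kx0 xB; rewrite leqNgt many.
  have [j hj] : exists j, (x0 *m Bq f q0) 0 j != bq q0 0 j.
    by apply: contrapT => nj; apply: xB; apply/rowP => j; apply/eqP; apply: contraT => h; case: nj; exists j.
  pose h := `|(x0 *m Bq f q0) 0 j - bq q0 0 j|.
  have h0 : 0 < h by rewrite normr_gt0 subr_eq0.
  pose L : R := m%:R * (C + (1 + 1)) + S + 1.
  have L0 : 0 < L by rewrite ltr_wpDl // addr_ge0 // ?(ltW S0) // mulr_ge0 // addr_ge0 // ltW.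
  pose e : R := Num.min (h / L) 1.
  have e0 : 0 < e by rewrite lt_min divr_gt0 ?ltr01.
  have e1 : e <= 1 by rewrite ge_min lexx orbT.
  exists ([set x : 'rV[R]_m | forall i a, `|x0 i a - x i a| < e],
       [set dq : 'rV[R]_(m * c + c) * R | forall i a, `|q0 i a - dq.1 i a| < e]).
    split; first by apply/nbhs_mxP; exists e.
    exists ([set q : 'rV[R]_(m * c + c) | forall i a, `|q0 i a - q i a| < e], setT).
      by split; [apply/nbhs_mxP; exists e|exact: filterT].
    by move=> [q d] /= [].
  move=> [x [q d]] /= [xx0 qq0] _ xBq; exfalso.
  have cB a : `|Bq f q0 a j - Bq f q a j| <= e.
    rewrite !mxE; case: pickP => [i _|_]; last exact/ltW/qq0.
    by rewrite subrr normr0 ltW.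
  have bB a : `|Bq f q a j| <= 1 + 1.
    rewrite -[Bq f q a j](subrK (Bq f q0 a j)) (le_trans (ler_normD _ _)) // lerD ?nB.1 //.
    by rewrite distrC (le_trans (cB a)).
  have d1 : `|(x0 *m Bq f q0) 0 j - (x *m Bq f q) 0 j| <= m%:R * (C * e + (1 + 1) * e).
    rewrite !mxE -[m in m%:R]card_ord; apply: ler_dist_sum.
      by rewrite addr_ge0 ?mulr_ge0 ?addr_ge0 // ltW.
    move=> a _; apply: ler_dist_mul => //; first exact: (iffLR (BxP _) Bx0).
    exact/ltW/xx0.
  have d2 : `|bq q0 0 j - bq q 0 j| <= S * e.
    by rewrite !mxE -mulrBr normrM gtr0_norm // ler_pM2l // ltW.
  have : h <= m%:R * (C * e + (1 + 1) * e) + S * e.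
    rewrite /h; move: d1 d2; rewrite xBq !ler_norml => /andP[? ?] /andP[? ?].
    by apply/andP; split; lra.
  have : L * e <= h by rewrite mulrC -ler_pdivlMr // ge_min lexx.
  by rewrite /L; lra.
case=> -[U1 U2] /= [q1 d2] U12; exists (U1, U2) => // -[q d] /= [Uq Ud] _.
exists t => x xC; exact: (U12 (q, d) (conj Uq Ud) x (iffRL (BxP _) xC)).
Unshelve. all: by end_near. Qed.

(** * Approximation by maps into complexes *)

(** The members of the cover are replaced one at a time by the positivity sets of
Urysohn functions, so that the sets still cover the space. *)
Lemma partition_of_unity (R : realType) (X : topologicalType) (J : finType)
    (U : J -> set X) : normal_space X -> (forall j, open (U j)) ->
  \bigcup_j U j = [set: X] ->
  exists lam : J -> X -> R, [/\ forall j, continuous (lam j),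
    forall j x, 0 <= lam j x, forall j x, lam j x != 0 -> U j x &
    forall x, \sum_j lam j x = 1].
Proof.
move=> nX oU covU.
suff [lam [lc l0 lU lpos]] : exists lam : J -> X -> R,
    [/\ forall j, continuous (lam j), forall j x, 0 <= lam j x,
        forall j x, lam j x != 0 -> U j x & forall x, exists j, 0 < lam j x].
  have S0 x : 0 < \sum_j lam j x.
    by have [j lj] := lpos x; rewrite (bigD1 j) //= ltr_pwDl // sumr_ge0.
  have Sc : continuous (fun x => \sum_j lam j x).
    by apply: continuous_big; [exact: add_continuous|move=> j _; exact: lc].
  exists (fun j x => lam j x / \sum_i lam i x); split.
  - move=> j x; have k1 := @cvgV R _ (nbhs x) (nbhs_filter x) _ _ (lt0r_neq0 (S0 x)) (Sc x).
    exact: (@cvgM R _ (nbhs x) (nbhs_filter x) _ _ _ _ (lc j x) k1).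
  - by move=> j x; rewrite divr_ge0 // ltW.
  - by move=> j x; rewrite mulf_eq0 negb_or => /andP[+ _]; exact: lU.
  - by move=> x; rewrite -mulr_suml divff // gt_eqF.
pose good (lam : J -> X -> R) (s : seq J) (j : J) : set X :=
  if j \in s then [set x | 0 < lam j x] else U j.
suff H (s : seq J) : exists lam : J -> X -> R,
    [/\ forall j, continuous (lam j), forall j x, 0 <= lam j x,
        forall j x, lam j x != 0 -> U j x & forall x, exists j, good lam s j x].
  have [lam [lc l0 lU lpos]] := H (enum J); exists lam; split => // x.
  by have [j] := lpos x; rewrite /good mem_enum; exists j.
elim: s => [|j0 s [lam [lc l0 lU lg]]].
  exists (fun _ _ => 0); split => //.
  - by move=> j; exact: cst_continuous.
  - by move=> j x; rewrite eqxx.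
  - move=> x; have [j _ Ujx] : (\bigcup_j U j) x by rewrite covU.
    by exists j; rewrite /good in_nil.
have og j : open (good lam s j).
  rewrite /good; case: ifP => _; last exact: oU.
  apply: (@open_comp _ _ (lam j) [set x | 0 < x]); last exact: open_gt.
  by move=> x _; exact: lc.
pose A := ~` \bigcup_(j in [set j | j != j0]) good lam s j.
have cA : closed A by apply: open_closedC; apply: bigcup_open => j _; exact: og.
have cB : closed (~` good lam s j0) by exact: open_closedC.
have AB : (~` good lam s j0) `&` A = set0.
  apply/seteqP; split => // x [nB nA]; have [j gj] := lg x.
  have [jj|jj] := eqVneq j j0; first by apply: nB; rewrite -jj.
  by apply: nA; exists j.
have sep := @normal_separatorP R X.
have /(@uniform_separatorP X R)[f [fc f01 f0 f1]] := iffLR sep nX _ _ cB cA AB.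
have f_ge0 x : 0 <= f x.
  have : `[0, 1]%classic (f x) by apply: f01; exists x.
  by rewrite /= in_itv /= => /andP[].
exists (fun j => if j == j0 then f else lam j); split.
- by move=> j; case: ifP.
- by move=> j x; case: ifP.
- move=> j x; case: (j =P j0) => [-> fx|_]; last exact: lU.
  have : good lam s j0 x.
    by apply: contrapT => nx; move/eqP: fx; apply; exact: f0 (imageP f nx).
  by rewrite /good; case: ifP => // _ /= lx; apply: lU; rewrite gt_eqF.
- move=> x; have [[j [jj gj]]|none] := pselect (exists j, j != j0 /\ good lam s j x).
    exists j; move: gj; rewrite /good in_cons (negbTE jj) /=.
    by case: ifP.
  exists j0; rewrite /good in_cons eqxx /=.
  have fx : f x = 1.
    by apply: f1; exists x => //= -[j jj gj]; apply: none; exists j.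
  by rewrite fx ltr01.
Qed.

(** A refinement of order [n + 1] of a cover on which [f] varies little, with a
partition of unity subordinate to it: the weights [lam x] place [x] in a
simplex of dimension at most [n] with vertices near [f x]. *)
Lemma pl_approximation (R : realType) (X : topologicalType) (n m : nat)
    (f : X -> 'rV[R]_m) (M eta : R) :
  normal_space X -> dim_le X n%:Z -> continuous f ->
  0 <= M -> (forall x a, `|f x 0 a| <= M) -> 0 < eta ->
  exists N (V : 'M[R]_(N, m)) (lam : X -> 'rV[R]_N),
    [/\ forall j, continuous (fun x => lam x 0 j),
        forall x j, 0 <= lam x 0 j, forall x, \sum_j lam x 0 j = 1,
        forall x, (#|[pred j | (lam x 0 j != 0)%R]| <= n.+1)%N &
        forall x j, lam x 0 j != 0 -> forall a, `|V j a - f x 0 a| <= eta].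
Proof.
move=> nX [_ dimX] fc M0 fM eta0.
have [[x0 _]|nX0] := pselect ([set: X] !=set0); last first.
  exists 0%N, 0, (fun=> 0); split => x; try by case: nX0; exists x.
  by case: x.
have [K KP] : exists K : nat, (M + M) / (eta / 2) < K%:R.
  exists (Num.bound ((M + M) / (eta / 2))); apply: archi_boundP.
  by rewrite divr_ge0 ?addr_ge0 // divr_ge0 // ltW.
pose I : finType := {ffun 'I_m -> 'I_K}.
pose ctr (i : I) : 'rV[R]_m := \row_a (- M + eta / 2 * (i a)%:R).
pose box (i : I) : set 'rV[R]_m := [set y | forall a, `|ctr i 0 a - y 0 a| <= eta].
pose U (i : I) : set X := f @^-1` (interior (box i)).
have oU i : open (U i).
  by apply: open_comp; [move=> x _; exact: fc|exact: open_interior].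
have covU : \bigcup_i U i = [set: X].
  apply/seteqP; split => // x _.
  have r0 a : 0 <= (f x 0 a + M) / (eta / 2).
    apply: divr_ge0; last by rewrite divr_ge0 // ltW.
    by have := fM x a; rewrite ler_norml => /andP[? _]; lra.
  have rK a : (Num.truncn ((f x 0 a + M) / (eta / 2))%R < K)%N.
    rewrite truncn_lt_nat // (le_lt_trans _ KP) // ler_pM2r ?invr_gt0 ?divr_gt0 //.
    by rewrite lerD2r; have := fM x a; rewrite ler_norml => /andP[].
  exists [ffun a => Ordinal (rK a)] => //; rewrite /U /= /interior.
  apply/nbhs_mxP; exists (eta / 2); first by rewrite divr_gt0.
  move=> y fy a; have := fy 0 a; rewrite mxE ffunE /=.
  have /andP[] := truncn_itv (r0 a).
  rewrite ler_pdivlMr ?divr_gt0 // ltr_pdivrMr ?divr_gt0 // -[(Num.truncn _).+1%:R]natr1.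
  set q := (Num.truncn _)%:R => h1 h2.
  rewrite ltr_norml ler_norml => /andP[? ?]; apply/andP; split; lra.
have [J [W [oW covW subW ordW]]] := dimX I U oU covU.
have [lam [lc l0 lW l1]] := partition_of_unity R nX oW covW.
have /choice[r rP] := subW.
exists #|J|, (\matrix_(j, a) ctr (r (enum_val j)) 0 a),
  (fun x => \row_j lam (enum_val j) x); split.
- move=> j; rewrite (_ : (fun x => _) = lam (enum_val j)); first exact: lc.
  by apply/funext => x; rewrite mxE.
- by move=> x j; rewrite mxE.
- move=> x; rewrite -(l1 x) [RHS](reindex (@enum_val _ (mem J))) /=; last first.
    by apply: onW_bij; exact: enum_val_bij.
  by apply: eq_bigr => j _; rewrite mxE.
- move=> x; have := ordW x; have -> : n%:Z + 1 = n.+1%:Z by lia.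
  rewrite lez_nat; apply: leq_trans.
  rewrite -(card_imset _ (@enum_val_inj _ (mem J))).
  apply: subset_leq_card; apply/fintype.subsetP => _ /imsetP[j + ->].
  by rewrite !inE mxE => /lW.
- move=> x j; rewrite mxE => /lW Wx a; rewrite mxE.
  by have /interior_subset := rP _ _ Wx; exact.
Qed.

Lemma continuous_mx (R : realType) (X : topologicalType) (m n : nat)
    (F : X -> 'M[R]_(m, n)) :
  (forall i j, continuous (fun x => F x i j)) -> continuous F.
Proof.
move=> Fc x A /nbhs_mxP[e e0 eA].
have H : \forall y \near x, forall i, forall j, `|F x i j - F y i j| < e.
  apply: (@filter_forall X 'I_m (fun i y => forall j, `|F x i j - F y i j| < e) (nbhs x) (nbhs_filter x)) => i.
  apply: (@filter_forall X 'I_n (fun j y => `|F x i j - F y i j| < e) (nbhs x) (nbhs_filter x)) => j.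
  have /cvgrPdist_lt := Fc i j x.
  by move=> /(_ e e0).
by apply: filterS H => y xy; apply: eA => i j; exact: xy.
Qed.

Lemma mulmxr_continuous (R : realType) (N m : nat) (V : 'M[R]_(N, m)) :
  continuous (fun t : 'rV[R]_N => t *m V).
Proof.
apply: continuous_mx => i j.
rewrite (_ : (fun t : 'rV[R]_N => _) = fun t => \sum_v t i v * V v j); last first.
  by apply/funext => t; rewrite mxE.
apply: continuous_big; first exact: add_continuous.
move=> v _ t.
exact: (@cvgMr_tmp R _ (nbhs t) (nbhs_filter t) _ _ (V v j) (@coord_continuous R 1 N i v t)).
Qed.

(** It is a finite union of linear images of compact simplices. *)
Lemma star_complex_closed (R : realType) (N m n : nat) (V : 'M[R]_(N, m)) (eta : R) :
  closed (star_complex V n eta).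
Proof.
pose good (S : {set 'I_N}) := (#|S| <= n.+1)%N /\
  forall v w a, v \in S -> w \in S -> `|V v a - V w a| <= eta.
pose simplex (S : {set 'I_N}) : set 'rV[R]_N :=
  [set t : 'rV[R]_N | forall v, `[0, (v \in S)%:R]%classic (t ord0 v)] `&`
  (fun t : 'rV[R]_N => t *m (const_mx 1 : 'M[R]_(N, 1))) @^-1` [set const_mx 1 : 'rV[R]_1].
have cS S : compact (simplex S).
  apply: compact_closedI.
    apply: (@rV_compact R N (fun v => `[0, (v \in S)%:R]%classic)) => v.
    exact: segment_compact.
  apply: (@closed_comp _ _ (fun t : 'rV[R]_N => t *m (const_mx 1 : 'M[R]_(N, 1)))).
    by move=> t _; exact: mulmxr_continuous.
  apply: accessible_closed_set1; apply: hausdorff_accessible.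
  exact: norm_hausdorff.
have -> : star_complex V n eta =
    \bigcup_(S in good) ((fun t : 'rV[R]_N => t *m V) @` simplex S).
  apply/seteqP; split => [x [t [t0 t1 tn tV ->]]|x [S [Sn SV] [t [/= tS t1] <-]]].
    exists [set v | t 0 v != 0]%SET.
      split; first by rewrite cardsE.
      by move=> v w a; rewrite !finset.inE; exact: tV.
    exists t => //; split => /=.
      move=> v; rewrite in_itv /= t0 finset.inE /=.
      have [->|_] := eqVneq (t 0 v) 0; first by [].
      by rewrite -t1 (bigD1 v) //= lerDl sumr_ge0.
    apply/rowP => j; rewrite !mxE -[RHS]t1.
    by apply: eq_bigr => v _; rewrite mxE mulr1.
  have t0 v : 0 <= t 0 v by have := tS v; rewrite in_itv /= => /andP[].
  have St v : t 0 v != 0 -> v \in S.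
    apply: contraNT => vS; have := tS v; rewrite in_itv /= (negbTE vS) => le0.
    by rewrite eq_le andbC.
  exists t; split => //.
  - have := congr1 (fun y : 'rV[R]_1 => y 0 0) t1; rewrite !mxE => t1'.
    rewrite -[RHS]t1'.
    by apply: eq_bigr => v _; rewrite mxE mulr1.
  - by apply: leq_trans Sn; apply: subset_leq_card; apply/fintype.subsetP => v; rewrite inE; exact: St.
  - by move=> v w a /St vS /St wS; exact: SV.
apply: closed_bigcup; first exact: finite_finset.
move=> S _; apply: compact_closed; first exact: norm_hausdorff.
apply: continuous_compact; last exact: cS.
by apply: continuous_subspaceT; exact: mulmxr_continuous.
Qed.

(** The number [D] of vertices that the grid has to avoid depends on [c] and [m]
only, and not on the number of simplices. Hence the simplices can be taken so
small, compared with [eps / D], that [slice_grid] applies. *)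
Lemma thin_approximation (R : realType) (X : topologicalType) (k c m : nat)
    (f : X -> 'rV[R]_m) (M delta eps : R) :
  normal_space X -> dim_le X (k + c)%N%:Z -> continuous f ->
  0 <= M -> (forall x a, `|f x 0 a| <= M) -> 0 < delta -> 0 < eps ->
  exists g : X -> 'rV[R]_m, [/\ continuous g,
    forall x a, `|g x 0 a - f x 0 a| < delta &
    grid_thin c k eps (closure (range g))].
Proof.
move=> nX dX fc M0 fM delta0 eps0.
pose D := ((c * m + c).+1 * c)%N.
pose eta := Num.min (Num.min delta 1) (eps / (4 * D.+1%:R)).
have D0 : 0 < D.+1%:R :> R by [].
have eta0 : 0 < eta by rewrite !lt_min delta0 ltr01 divr_gt0 // mulr_gt0.
have eta_delta : eta <= delta by rewrite !ge_min lexx.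
have eta1 : eta <= 1 by rewrite !ge_min lexx !orbT.
have eta_eps : 4 * eta * D.+1%:R <= eps.
  by rewrite mulrAC mulrC -ler_pdivlMr ?mulr_gt0 // ge_min lexx orbT.
have eta4 : 0 < eta / 4 by rewrite divr_gt0.
have [N [V0 [lam [lc l0 l1 ln lV]]]] := pl_approximation nX dX fc M0 fM eta4.
pose r : R := \sum_(a < m) (\sum_v \sum_a `|V0 v a| + 1).
have [V VV0 Vgen] := @generic_vertices R N m c V0 (eta / 4) r eta4.
have near_f x j : lam x 0 j != 0 -> forall a, `|V j a - f x 0 a| <= eta / 2.
  move=> /lV lVj a; have := ler_distD (V0 j a) (V j a) (f x 0 a).
  by have := VV0 j a; have := lVj a; lra.
pose g (x : X) := lam x *m V.
have gL x : star_complex V (k + c) eta (g x).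
  exists (lam x); split => //.
  move=> v w a /near_f fv /near_f fw; have := ler_distD (f x 0 a) (V v a) (V w a).
  by have := fv a; have := fw a; rewrite [`|f x 0 a - _|]distrC; lra.
exists g; split.
- have lamc : continuous lam.
    by apply: continuous_mx => i j; rewrite (ord1 i); exact: lc.
  move=> x; apply: (@continuous_comp _ _ _ lam (fun t => t *m V)).
    exact: lamc.
  exact: mulmxr_continuous.
- move=> x a.
  have -> : g x 0 a - f x 0 a = \sum_w lam x 0 w * (V w a - f x 0 a).
    rewrite (eq_bigr (fun w => lam x 0 w * V w a - lam x 0 w * f x 0 a)); last first.
      by move=> w _; rewrite mulrBr.
    by rewrite sumrB -mulr_suml l1 mul1r /g mxE.
  apply: (@le_lt_trans _ _ (eta / 2)); last by lra.
  rewrite (le_trans (ler_norm_sum _ _ _)) // -[leRHS]mul1r -[X in _ <= X * _](l1 x) mulr_suml.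
  apply: ler_sum => w _; rewrite normrM ger0_norm ?l0 //.
  have [->|tw] := eqVneq (lam x 0 w) 0; first by rewrite !mul0r.
  by apply: ler_wpM2l; [exact: l0|exact: near_f].
have clL : closure (range g) `<=` star_complex V (k + c) eta.
  rewrite [X in _ `<=` X](closure_id _).1; last exact: star_complex_closed.
  by apply: closure_subset => _ [x _ <-]; exact: gL.
move=> B b nB.
have [[x1 [x1L x1B]]|none] := pselect (exists x, star_complex V (k + c) eta x /\ x *m B = b); last first.
  exists 0 => x Kx xB; case: none; exists x; split => //; exact: clL.
have br j : `|b 0 j| <= r.
  rewrite -x1B mxE (le_trans (ler_norm_sum _ _ _)) // /r.
  apply: ler_sum => a _; rewrite normrM -[leRHS]mulr1 ler_pM // ?nB.1 //.
  have [t [t0 t1 _ _ ->]] := x1L; rewrite mxE (le_trans (ler_norm_sum _ _ _)) //.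
  rewrite -[leRHS]mul1r -[X in _ <= X * _]t1 mulr_suml; apply: ler_sum => v _.
  rewrite normrM ger0_norm // ler_wpM2l //.
  have := ler_distD (V0 v a) (V v a) 0; rewrite !subr0 => /le_trans; apply.
  rewrite addrC lerD //; last by have := VV0 v a; lra.
  rewrite (bigD1 v) //= (bigD1 a) //= -addrA lerDl addr_ge0 //.
    exact: sumr_ge0.
  by apply: sumr_ge0 => ? _; exact: sumr_ge0.
have := @disjoint_or_hitting _ (fun A => (#|A| <= c)%N /\ dependent (offset V B b) A) c
   (c * m + c).+1 (fun A => @proj1 _ _).
case=> [[A [PA dA]]|[Y [cY hY]]].
  by case: (Vgen B b nB br); exists A.
have [t tP] := @slice_grid R N m c k V B b Y eps eta D cY eps0 eta0 eta1 eta_eps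
  (fun A Ac dA => hY A (conj Ac dA)).
by exists t => x Kx xB; apply: tP => //; exact: clL.
Qed.

(** * Equations of planes *)

(** After multiplication by the inverse of a square block of maximal determinant,
Cramer's rule makes every entry a quotient of two minors, the denominator being
the maximal one. *)
Lemma max_minor_normalized (R : realType) (m c : nat) (A : 'M[R]_(m, c)) :
  row_full A -> exists2 G : 'M[R]_c, G \in unitmx & normalized (A *m G).
Proof.
move=> rkA.
pose d (f : {ffun 'I_c -> 'I_m}) := `|\det (rowsub f A)|.
pose f0 : {ffun 'I_c -> 'I_m} := [ffun i => fullrankfun rkA i].
have df0 : 0 < d f0.
  have -> : d f0 = `|\det (rowsub (fullrankfun rkA) A)|.
    by congr `|\det _|; apply/matrixP => i j; rewrite !mxE ffunE.
  by rewrite normr_gt0 -unitfE -unitmxE fullrowsub_unit.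
case: (@arg_maxP _ _ _ f0 xpredT d isT) => f _ fmax.
have df : 0 < d f by exact: lt_le_trans df0 (fmax _ isT).
have uf : rowsub f A \in unitmx by rewrite unitmxE unitfE -normr_gt0.
exists (invmx (rowsub f A)); first by rewrite unitmx_inv.
set B := A *m _.
have Bf : rowsub f B = 1%:M.
  rewrite -(mulmxV uf); apply/matrixP => i j; rewrite !mxE.
  by apply: eq_bigr => l _; rewrite !mxE.
split; last first.
  exists f => i j; have := congr1 (fun M : 'M[R]_(c, c) => M i j) Bf.
  by rewrite !mxE => ->.
move=> a j.
pose f' : {ffun 'I_c -> 'I_m} := [ffun i => if i == j then a else f i].
have Bf'E : rowsub f' B = rowsub f' A *m invmx (rowsub f A).
  by apply/matrixP => i l; rewrite !mxE; apply: eq_bigr => l' _; rewrite !mxE.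
have detB : \det (rowsub f' B) = B a j.
  rewrite (expand_det_row _ j) (bigD1 j) //= big1 ?addr0.
    rewrite !mxE ffunE eqxx.
    have -> : cofactor (rowsub f' B) j j = 1.
      have <- : \adj (1%:M : 'M[R]_c) j j = 1 by rewrite adj1 mxE eqxx.
      rewrite mxE /cofactor; congr (_ * \det _); apply/matrixP => i l.
      rewrite -Bf !mxE ffunE; case: eqP => // /eqP.
      by rewrite eq_sym (negbTE (neq_lift _ _)).
    by rewrite mulr1.
  move=> l lj.
  have -> : cofactor (rowsub f' B) j l = 0; last by rewrite mulr0.
  have <- : \adj (1%:M : 'M[R]_c) l j = 0 by rewrite adj1 mxE (negbTE lj).
  rewrite mxE /cofactor; congr (_ * \det _); apply/matrixP => i l'.
  rewrite -Bf !mxE ffunE; case: eqP => // /eqP.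
  by rewrite eq_sym (negbTE (neq_lift _ _)).
rewrite -detB Bf'E det_mulmx det_inv normrM normfV ler_pdivrMr // mul1r.
exact: fmax.
Qed.

Lemma mulmx_col_base_eq0 (R : realType) (m p : nat) (C : 'M[R]_(m, p))
    (G : 'M[R]_(\rank C)) (y : 'rV[R]_m) :
  G \in unitmx -> (y *m C == 0) = (y *m (col_base C *m G) == 0).
Proof.
move=> uG.
have {1}-> : y *m C = y *m col_base C *m row_base C by rewrite -mulmxA mulmx_base.
rewrite (mulmxA y (col_base C) G); move: (y *m col_base C) => z; apply/eqP/eqP => z0.
  have /row_freeP[D rD] := row_base_free C.
  by rewrite -[z]mulmx1 -rD (mulmxA z) z0 !mul0mx.
by rewrite -[z](mulmxK uG) z0 !mul0mx.
Qed.

Lemma affine_plane_equations (R : realType) (m d : nat) (P : set 'rV[R]_m) :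
  affine_plane d P ->
  exists (B : 'M[R]_(m, (m - d)%N)) (b : 'rV[R]_(m - d)),
    normalized B /\ P = [set x | x *m B = b].
Proof.
case=> p [V [dimV ->]].
pose A : 'M[R]_(\dim V, m) := \matrix_i (vbasis V)`_i.
have VA x : (x \in V) = (x <= A)%MS.
  apply/idP/submxP => [xV|[D ->]].
    exists (\row_i coord (vbasis V) i x).
    rewrite {1}(coord_vbasis xV) mulmx_sum_row; apply: eq_bigr => i _.
    by rewrite mxE rowK.
  rewrite mulmx_sum_row; apply: memv_suml => i _; apply: memvZ.
  by rewrite rowK; apply: vbasis_mem; rewrite mem_nth // size_tuple.
have rkA : \rank A = d.
  rewrite -dimV; apply/eqP; rewrite -/(row_free A); apply/row_freeP.
  exists (\matrix_(j, i) coord (vbasis V) i (delta_mx 0 j)).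
  apply/matrixP => i j; rewrite !mxE.
  have := coord_free i j (basis_free (vbasisP V)); rewrite eq_sym => <-.
  rewrite [in RHS](row_sum_delta (vbasis V)`_i) linear_sum /=; apply: eq_bigr => l _.
  by rewrite linearZ /= !mxE.
have rkC : \rank (cokermx A) = (m - d)%N by rewrite mxrank_coker rkA.
case: _ / rkC.
pose C := cokermx A.
have fullC : row_full (col_base C) by exact: col_base_full.
have [G uG nG] := max_minor_normalized fullC.
exists (col_base C *m G), (p *m (col_base C *m G)); split=> //.
have inj (y : 'rV[R]_m) := mulmx_col_base_eq0 y uG.
apply/seteqP; split=> x /=; rewrite VA submxE -/C inj mulmxBl subr_eq0.
  by move=> /eqP.
by move=> ->.
Qed.

(** * Bounded maps with the uniform topology *)

Lemma bounded_fun_coordP (R : realType) (X : Type) (m : nat) (f : X -> 'rV[R]_m) :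
  bounded_fun f <-> exists2 M : R, 0 <= M & forall x a, `|f x 0 a| <= M.
Proof.
split.
  move=> [M [_ MP]]; exists (Num.max 0 (M + 1)); first by rewrite le_max lexx.
  move=> x a; have := MP (Num.max 0 (M + 1)); rewrite lt_max ltrDl ltr01 orbT.
  move=> /(_ isT x I) /=; apply: le_trans.
  rewrite [leRHS]/Num.norm /= mx_normrE.
  by rewrite (@le_bigmax _ _ _ 0 (fun ij : 'I_1 * 'I_m => `|f x ij.1 ij.2|) (0, a)).
move=> [M M0 MP]; exists M; split; first exact: num_real.
move=> M' MM' x _ /=; rewrite [leLHS]/Num.norm /= mx_normrE.
apply/bigmax_leP; split; first exact: le_trans (ltW MM').
by move=> [i a] _ /=; rewrite (ord1 i) (le_trans (MP x a)) // ltW.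
Qed.

Section BoundedMaps.
Context {R : realType} {X : topologicalType} {m : nat}.
Local Notation C := (set_type (Cstar R X m)).

Definition bmap (g : C) : X -> 'rV[R]_m := set_val g.

Lemma bmap_continuous (g : C) : continuous (bmap g).
Proof. exact: (set_valP g).1. Qed.

Lemma bmap_bounded (g : C) :
  exists2 M : R, 0 <= M & forall x a, `|bmap g x 0 a| <= M.
Proof. exact: (iffLR (bounded_fun_coordP _) (set_valP g).2). Qed.

Lemma bmap_ex (f : X -> 'rV[R]_m) (M : R) : continuous f ->
  (forall x a, `|f x 0 a| <= M) -> exists g : C, bmap g = f.
Proof.
move=> fc fM.
have Cf : Cstar R X m f.
  split => //; apply/bounded_fun_coordP; exists (Num.max 0 M).
    by rewrite le_max lexx.
  by move=> x a; rewrite le_max fM orbT.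
by exists (exist _ f (mem_set Cf)).
Qed.

Lemma nbhs_bmapP (g : C) (A : set C) :
  nbhs g A <-> exists2 d : R, 0 < d &
    forall h : C, (forall x a, `|bmap g x 0 a - bmap h x 0 a| < d) -> A h.
Proof.
split=> [|[d d0 dA]].
  rewrite nbhsE => -[B [[W oW WB] Bg] BA].
  have : nbhs (set_val g : {uniform X -> 'rV[R]_m}) W.
    by apply: open_nbhs_nbhs; split => //; move: Bg; rewrite -WB.
  move=> /uniform_nbhs[E [entE EW]].
  move: entE; rewrite -entourage_ballE => -[d /= d0 dE].
  exists d => // h gh; apply: BA; rewrite -WB; apply: EW => x _ /=.
  by apply: dE; split => // i a; rewrite (ord1 i); exact: gh.
have H : nbhs (set_val g : {uniform X -> 'rV[R]_m})
    [set h | forall x a, `|bmap g x 0 a - (h : X -> 'rV[R]_m) x 0 a| < d].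
  apply/uniform_nbhs; exists [set xy | ball xy.1 d xy.2]; split.
    by rewrite -entourage_ballE; exists d.
  by move=> h gh x a; have [_ /(_ 0 a)] := gh x I.
have := @initial_continuous _ _ (set_val : C -> {uniform X -> 'rV[R]_m}) g _ H.
by apply: (@filterS C (nbhs g) (nbhs_filter g)) => h gh; exact: dA.
Qed.

Lemma open_bmapP (A : set C) :
  (forall g, A g -> exists2 d : R, 0 < d &
    forall h : C, (forall x a, `|bmap g x 0 a - bmap h x 0 a| < d) -> A h) ->
  open A.
Proof. by move=> H; rewrite openE => g /H gA; apply/nbhs_bmapP. Qed.

(** The values of the limit are suprema of the left ends of the nested intervals
of centre [u i x] and radius [r i]. *)
Lemma uniform_limit_bmap (u : nat -> C) (r : nat -> R) :
  (forall e, 0 < e -> exists i, r i < e) ->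
  (forall i j x a, `|bmap (u i) x 0 a - bmap (u j) x 0 a| <= r i + r j) ->
  exists g : C, forall i x a, `|bmap g x 0 a - bmap (u i) x 0 a| <= r i.
Proof.
move=> r0 ur.
pose E x a : set R := [set z | exists i, z = bmap (u i) x 0 a - r i].
have Eub j x a : ubound (E x a) (bmap (u j) x 0 a + r j).
  move=> _ [i ->]; have := ur i j x a; rewrite ler_norml => /andP[_]; lra.
have Esup x a : has_sup (E x a).
  split; first by exists (bmap (u 0%N) x 0 a - r 0%N); exists 0%N.
  by exists (bmap (u 0%N) x 0 a + r 0%N); exact: Eub.
pose g (x : X) : 'rV[R]_m := \row_a sup (E x a).
have gu i x a : `|g x 0 a - bmap (u i) x 0 a| <= r i.
  rewrite mxE ler_norml; apply/andP; split.
    rewrite lerBrDr addrC; apply: (ub_le_sup (Esup x a).2); by exists i.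
  rewrite lerBlDr addrC; apply: (ge_sup (Esup x a).1); exact: Eub.
have gc : continuous g.
  apply: continuous_mx => o a; rewrite (ord1 o) => x.
  apply/cvgrPdist_lt => e e0.
  have [i ri] := r0 (e / 4) (divr_gt0 e0 (ltr0n _ 4)).
  have uc : (fun y => bmap (u i) y 0 a) @ x --> bmap (u i) x 0 a.
    apply: (@continuous_comp _ _ _ (bmap (u i)) (fun v : 'rV[R]_m => v 0 a)).
      exact: bmap_continuous.
    exact: coord_continuous.
  move/cvgrPdist_lt : uc => /(_ (e / 4) (divr_gt0 e0 (ltr0n _ 4))).
  apply: filterS => y; have := gu i x a; have := gu i y a.
  rewrite !ler_norml !ltr_norml => /andP[? ?] /andP[? ?] /andP[? ?].
  by apply/andP; split; lra.
have [M M0 MP] := bmap_bounded (u 0%N).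
have [h hg] : exists h : C, bmap h = g.
  apply: (@bmap_ex g (M + r 0%N)) => // x a.
  rewrite -[g x 0 a](subrK (bmap (u 0%N) x 0 a)) addrC.
  by rewrite (le_trans (ler_normD _ _)) // lerD.
by exists h; rewrite hg.
Qed.

(** The Baire category theorem for bounded continuous maps with the uniform metric,
by nested balls. *)
Lemma bmap_baire (O : nat -> set C) : (forall i, open (O i)) ->
  (forall i (g : C) (e : R), 0 < e -> exists2 h, O i h &
     forall x a, `|bmap g x 0 a - bmap h x 0 a| < e) ->
  dense (\bigcap_i O i).
Proof.
move=> oO dO W [g0 Wg0] oW.
have nbW : nbhs g0 W by apply: open_nbhs_nbhs.
have [d0 d00 d0W] := iffLR (nbhs_bmapP _ _) nbW.
pose P (i : nat) (p q : C * R) := 0 < p.2 -> [/\ 0 < q.2, q.2 <= p.2 / 2,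
  forall h : C, (forall x a, `|bmap q.1 x 0 a - bmap h x 0 a| <= q.2) -> O i h &
  forall x a, `|bmap p.1 x 0 a - bmap q.1 x 0 a| <= p.2 / 2].
have /choice[next nextP] : forall ip : nat * (C * R), exists q, P ip.1 ip.2 q.
  move=> [i [g r]]; rewrite /P /=.
  have [r0|r0] := ltP 0 r; last by exists (g, r).
  have [h Oh gh] := dO i g (r / 2) (divr_gt0 r0 (ltr0n _ 2)).
  have nbh : nbhs h (O i) by apply: open_nbhs_nbhs; split.
  have [d d_gt0 dP] := iffLR (nbhs_bmapP _ _) nbh.
  exists (h, Num.min (d / 2) (r / 2)) => _ /=; split.
  - by rewrite lt_min !divr_gt0.
  - by rewrite ge_min lexx orbT.
  - move=> h' hh'; apply: dP => x a; apply: le_lt_trans (hh' x a) _.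
    by rewrite gt_min; apply/orP; left; lra.
  - by move=> x a; exact/ltW.
pose s := fix s (n : nat) : C * R :=
  if n is i.+1 then next (i, s i) else (g0, d0 / 2).
have spos i : 0 < (s i).2.
  by elim: i => [|i IH] /=; [rewrite divr_gt0|have [] := nextP (i, s i) IH].
have sP i : [/\ (s i.+1).2 <= (s i).2 / 2,
  forall h : C, (forall x a, `|bmap (s i.+1).1 x 0 a - bmap h x 0 a| <= (s i.+1).2) -> O i h &
  forall x a, `|bmap (s i).1 x 0 a - bmap (s i.+1).1 x 0 a| <= (s i).2 / 2].
  by have [] := nextP (i, s i) (spos i).
have near_s i j x a :
    `|bmap (s i).1 x 0 a - bmap (s (i + j)%N).1 x 0 a| <= (s i).2 - (s (i + j)%N).2.
  elim: j => [|j IH]; first by rewrite addn0 !subrr normr0.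
  rewrite addnS; have [h1 _ h3] := sP (i + j)%N; have := h3 x a.
  have := ler_distD (bmap (s (i + j)%N).1 x 0 a) (bmap (s i).1 x 0 a) (bmap (s (i + j).+1).1 x 0 a).
  by move: IH h1; lra.
have small e : 0 < e -> exists i, (s i).2 < e.
  move=> e0.
  have pw i : (s i).2 * 2 ^+ i <= (s 0%N).2.
    elim: i => [|i IH]; first by rewrite expr0 mulr1.
    have [h1 _ _] := sP i; apply: le_trans IH; rewrite exprS mulrA.
    by rewrite ler_pM2r ?exprn_gt0 //; lra.
  exists (Num.bound ((s 0%N).2 / e)); set i := Num.bound _.
  have : (s 0%N).2 / e < 2 ^+ i.
    rewrite (lt_trans (archi_boundP _)) ?divr_ge0 ?ltW //.
    by rewrite -natrX ltr_nat ltn_expl.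
  rewrite ltr_pdivrMr // => lt.
  have := le_lt_trans (pw i) lt; rewrite mulrC ltr_pM2l ?exprn_gt0 //.
have [g gP] : exists g : C, forall i x a,
    `|bmap g x 0 a - bmap (s i).1 x 0 a| <= (s i).2.
  apply: uniform_limit_bmap => // i j x a.
  have [ij|ji] := leqP i j.
    by have := near_s i (j - i)%N x a; rewrite subnKC //; have := spos j; lra.
  have := near_s j (i - j)%N x a; rewrite subnKC 1?ltnW // distrC.
  by have := spos i; lra.
exists g; split.
  apply: d0W => x a; rewrite distrC; apply: le_lt_trans (gP 0%N x a) _ => /=; lra.
move=> i _; have [_ h2 _] := sP i; apply: h2 => x a; rewrite distrC; exact: gP.
Qed.

End BoundedMaps.

(** * Generic maps *)

Definition thin_range (R : realType) (X : topologicalType) (m c k : nat) (eps : R)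
    (g : set_type (Cstar R X m)) : Prop :=
  grid_thin c k eps (closure (range (bmap g))).

Lemma closure_range_near (R : realType) (X : Type) (m : nat) (f g : X -> 'rV[R]_m)
    (d : R) : (forall x a, `|f x 0 a - g x 0 a| < d / 2) -> 0 < d ->
  forall y, closure (range g) y ->
    exists2 z, closure (range f) z & forall a, `|y 0 a - z 0 a| < d.
Proof.
move=> fg d0 y cy.
have [_ [[x _ <-] gy]] := cy [set z : 'rV[R]_m | forall i a, `|y i a - z i a| < d / 2]
  (nbhs_mx_box _ (divr_gt0 d0 (ltr0n _ 2))).
exists (f x); first by apply: subset_closure; exists x.
move=> a; have := ler_distD (g x 0 a) (y 0 a) (f x 0 a).
by have := gy 0 a; have := fg x a; rewrite [`|f x 0 a - _|]distrC; lra.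
Qed.

Lemma closure_range_bounded (R : realType) (X : Type) (m : nat) (f : X -> 'rV[R]_m)
    (M : R) : (forall x a, `|f x 0 a| <= M) ->
  forall y, closure (range f) y -> forall a, `|y 0 a| <= M.
Proof.
move=> fM y cy a; rewrite leNgt; apply/negP => My.
have e0 : 0 < `|y 0 a| - M by rewrite subr_gt0.
have [_ [[x _ <-] fy]] := cy [set z : 'rV[R]_m | forall i a', `|y i a' - z i a'| < `|y 0 a| - M]
  (nbhs_mx_box _ e0).
have := fy 0 a; have := fM x a; have := ler_distD (f x 0 a) (y 0 a) 0.
by rewrite !subr0; lra.
Qed.

Lemma thin_range_open (R : realType) (X : topologicalType) (m c k : nat) (eps : R) :
  0 < eps -> open [set g : set_type (Cstar R X m) | thin_range c k eps g].
Proof.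
move=> eps0; apply: open_bmapP => g tg.
have [M M0 gM] := bmap_bounded g.
have [d d0 dP] := grid_thin_stable eps0 (@closed_closure _ _)
  (closure_range_bounded gM) tg.
exists (d / 2); first by rewrite divr_gt0.
by move=> h gh; apply: dP; exact: closure_range_near.
Qed.

Lemma thin_range_dense (R : realType) (X : topologicalType) (m c k : nat) (eps : R) :
  normal_space X -> dim_le X (k + c)%N%:Z -> 0 < eps ->
  forall (g : set_type (Cstar R X m)) (e : R), 0 < e ->
  exists2 h, thin_range c k eps h &
    forall x a, `|bmap g x 0 a - bmap h x 0 a| < e.
Proof.
move=> nX dX eps0 g e e0; have [M M0 gM] := bmap_bounded g.
have [f [fc fg thin]] := thin_approximation nX dX (@bmap_continuous _ _ _ g) M0 gM e0 eps0.
have [h hf] : exists h : set_type (Cstar R X m), bmap h = f.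
  apply: (@bmap_ex _ _ _ f (e + M)) => // x a.
  rewrite -[f x 0 a](subrK (bmap g x 0 a)) (le_trans (ler_normD _ _)) // lerD //.
  exact/ltW/fg.
exists h; first by rewrite /thin_range hf.
by move=> x a; rewrite hf distrC.
Qed.

Lemma dim_le_slice (R : realType) (m c k : nat) (K : set 'rV[R]_m) (M : R)
    (B : 'M[R]_(m, c)) (b : 'rV[R]_c) :
  closed K -> (forall x, K x -> forall a, `|x 0 a| <= M) -> normalized B ->
  (forall e : R, 0 < e -> exists2 eps, 0 < eps <= e & grid_thin c k eps K) ->
  dim_le (set_type (K `&` [set x | x *m B = b])) k%:Z.
Proof.
move=> cK KM nB thin; apply: dim_le_grid.
  have cB : closed [set x : 'rV[R]_m | x *m B = b].
    apply: (@closed_comp _ _ (fun x : 'rV[R]_m => x *m B) [set b]).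
      by move=> x _; exact: mulmxr_continuous.
    by apply: accessible_closed_set1; apply: hausdorff_accessible; exact: norm_hausdorff.
  apply: subclosed_compact (closedI cK cB)
    (@rV_compact R m (fun=> `[- M, M]%classic) (fun=> @segment_compact R _ _)) _.
  by move=> x [Kx _] a; have := KM x Kx a; rewrite ler_norml /= in_itv.
move=> e /thin[eps epse th]; exists eps => //.
by have [t tP] := th B b nB; exists t => x [Kx xB]; exact: tP.
Qed.

Unset Implicit Arguments.

Theorem corollary1p4 (R : realType) (X : topologicalType) (n : int) (m : nat) :
  hausdorff_space X -> normal_space X -> dim_eq X n ->
  n + 1 <= m%:Z ->
  exists H : set (set_type (Cstar R X m)),
    [/\ dense H, Gdelta H &
        forall g : set_type (Cstar R X m), H g ->
        forall (d : nat) (P : set 'rV[R]_m),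
          m%:Z - n <= d%:Z -> (d <= m)%N -> affine_plane d P ->
          dim_le (set_type (closure (range (set_val g : X -> 'rV[R]_m)) `&` P))
                 (n + d%:Z - m%:Z)].
Proof.
move=> _ nX [dX _] _.
have [n1 _] := dX.
case: n dX n1 => n dX n1; last first.
  (* n = -1, and then no d satisfies m - n <= d <= m *)
  exists setT; split.
  - by move=> W W0 _; rewrite setIT.
  - by apply: open_Gdelta; exact: openT.
  - by move=> g _ d P; rewrite NegzE; lia.
(* the index i codes the codimension i %% m.+1, so that each codimension
   c <= m occurs with arbitrarily small meshes *)
pose mesh (i : nat) : R := i.+1%:R^-1.
pose H_ i : set (set_type (Cstar R X m)) :=
  [set g | (i %% m.+1 <= n)%N -> thin_range (i %% m.+1) (n - i %% m.+1) (mesh i) g].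
have mesh0 i : 0 < mesh i by rewrite invr_gt0.
have oH i : open (H_ i).
  have [cn|cn] := boolP (i %% m.+1 <= n)%N.
    rewrite (_ : H_ i = [set g | thin_range (i %% m.+1) (n - i %% m.+1) (mesh i) g]).
      exact: thin_range_open.
    by apply/seteqP; split => g /= Hg; [exact: Hg|move=> _].
  rewrite (_ : H_ i = setT); first exact: openT.
  by apply/seteqP; split => // g _ /= cn'; rewrite cn' in cn.
exists (\bigcap_i H_ i); split.
- apply: bmap_baire => // i g e e0.
  have [cn|cn] := boolP (i %% m.+1 <= n)%N.
    have [|h th gh] := @thin_range_dense R X m (i %% m.+1) (n - i %% m.+1) (mesh i) nX _ (mesh0 i) g e e0.
      by rewrite subnK.
    by exists h => // _.
  exists g; first by move=> cn'; rewrite cn' in cn.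
  by move=> x a; rewrite subrr normr0.
- by exists H_.
move=> g Hg d P dn dm /affine_plane_equations[B [b [nB ->]]].
have cn : (m - d <= n)%N by lia.
have -> : n%:Z + d%:Z - m%:Z = (n - (m - d))%N%:Z by lia.
have [M M0 gM] := bmap_bounded g.
apply: (@dim_le_slice R m (m - d) (n - (m - d)) (closure (range (bmap g))) M) => //.
- exact: closed_closure.
- exact: closure_range_bounded.
move=> e e0.
pose i := (Num.bound e^-1 * m.+1 + (m - d))%N.
have im : (i %% m.+1 = m - d)%N.
  by rewrite /i modnMDl modn_small // ltnS leq_subr.
exists (mesh i).
  rewrite mesh0 /= /mesh -[leRHS]invrK lef_pV2 ?posrE ?invr_gt0 //.
  apply: ltW; apply: lt_le_trans (archi_boundP _) _; first by rewrite invr_ge0 ltW.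
  by rewrite ler_nat /i; nia.
by have := Hg i I; rewrite /H_ /= im; exact.
Qed.
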